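(* Let $\rho$ be a bipartite multi-photon state and let $\sigma$ be its effective two-qubit state, obtained by applying the universal squash operation on each side. Let $A_1,A_2$ (first side) and $B_1,B_2$ (second side) be qubit observables with eigenvalues $+1$ and $-1$. For $i,j\in\{1,2\}$ let $P_{ij}^{\mathrm{s},+},P_{ij}^{\mathrm{s},-},P_{ij}^{\mathrm{d}}$ be the threshold-detection probabilities (defined in the context) when $\rho$ is measured with settings $A_i$ and $B_j$, and set $$E_{ij}^{\mathrm L}=P_{ij}^{\mathrm{s},+}-P_{ij}^{\mathrm{s},-}-P_{ij}^{\mathrm{d}},\qquad E_{ij}^{\mathrm U}=P_{ij}^{\mathrm{s},+}-P_{ij}^{\mathrm{s},-}+P_{ij}^{\mathrm{d}}.$$ Let $E[A_iB_j]=\operatorname{Tr}\big(\sigma\,(A_i\otimes B_j)\big)$ and $\chi=E[A_1B_1]+E[A_1B_2]+E[A_2B_1]-E[A_2B_2]$. Then $E_{ij}^{\mathrm L}\le E[A_iB_j]\le E_{ij}^{\mathrm U}$ for all $i,j$, and $$\chi^{\mathrm L}:=E_{11}^{\mathrm L}+E_{12}^{\mathrm L}+E_{21}^{\mathrm L}-E_{22}^{\mathrm U}\;\le\;\chi\;\le\;E_{11}^{\mathrm U}+E_{12}^{\mathrm U}+E_{21}^{\mathrm U}-E_{22}^{\mathrm L}.$$ Consequently, if $\chi^{\mathrm L}\ge2$, the fidelity $F$ of $\sigma$ to maximally entangled two-qubit states satisfies $$F\;\ge\;\frac{1+\sqrt{(\chi^{\mathrm L}/2)^2-1}}{2}.$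$
   Context: Single-photon polarization states live in $\mathbb{C}^2$. An $n$-photon signal is described on the symmetric subspace $\mathrm{Sym}^n(\mathbb{C}^2)\subset(\mathbb{C}^2)^{\otimes n}$. A bipartite multi-photon state is $\rho=\bigoplus_{n,m\ge1}p_{n,m}\rho_{n,m}$, where $(p_{n,m})$ is a probability distribution and $\rho_{n,m}$ is a density operator on $(\mathbb{C}^2)^{\otimes n}\otimes(\mathbb{C}^2)^{\otimes m}$ supported on $\mathrm{Sym}^n(\mathbb{C}^2)\otimes\mathrm{Sym}^m(\mathbb{C}^2)$ ($n$ photons on the first side, $m$ on the second). The universal squash operation $\Lambda_{n\to1}$ is the partial trace over $n-1$ of the $n$ tensor factors of an $n$-photon signal (by symmetry it does not matter which). The effective two-qubit state is $\sigma=\sum_{n,m}p_{n,m}(\Lambda_{n\to1}\otimes\Lambda_{m\to1})(\rho_{n,m})$. Threshold detection with settings $A_i,B_j$: every photon on the first side is measured with the observable $A_i$ and every photon on the second side with $B_j$. A side has a single click with value $s\in\{+1,-1\}$ if all of its photons give outcome $s$, and a double click if both outcomes $+1$ and $-1$ occur among its photons. $P_{ij}^{\mathrm{s},\pm}$ is the probability that both sides have a single click and the product of their two values is $\pm1$; $P_{ij}^{\mathrm{d}}$ is the probability that at least one side has a double click. Thus $P_{ij}^{\mathrm{s},+}+P_{ij}^{\mathrm{s},-}+P_{ij}^{\mathrm{d}}=1$. The fidelity of a two-qubit state $\sigma$ to maximally entangled states is $F=\max_{\Phi}\langle\Phi|\sigma|\Phi\rangle$ over all maximally entangled unit vectors $\Phi\in\mathbb{C}^2\otimes\mathbb{C}^2$.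 *)

(* Defs.v *)
From HB Require Import structures.
From mathcomp Require Import all_boot all_order all_algebra all_fingroup.
From mathcomp Require Import all_classical all_reals all_analysis.
From mathcomp Require Export sesquilinear spectral.
From mathcomp.real_closed Require Export complex mxtens.

Set Implicit Arguments.
Unset Strict Implicit.
Unset Printing Implicit Defensive.

Import Order.TTheory GRing.Theory Num.Theory.

Local Open Scope classical_set_scope.
Local Open Scope sesquilinear_scope.
Local Open Scope ring_scope.

(* Row-vector convention of MathComp: a ket is a row vector, an operator acts *)
(* by right multiplication u |-> u *m X, the inner product of u and v is      *)
(* u *m v^t*, the range of X is its row space, and the projector on the line  *)
(* of a unit vector u is u^t* *m u.                                           *)

(* The sum of a summable family of reals over an arbitrary index type; a junk *)
(* value otherwise. Every family summed below is dominated by a probability   *)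
(* distribution, hence summable.                                              *)
Definition rsum (R : realType) (I : choiceType) (f : I -> R) : R :=
  fine (\esum_(k in [set: I]) (Num.max (f k) 0)%:E)
  - fine (\esum_(k in [set: I]) (Num.max (- f k) 0)%:E).

Definition mxrsum (R : realType) (I : choiceType) (m n : nat)
    (X : I -> 'M[R[i]]_(m, n)) : 'M[R[i]]_(m, n) :=
  \matrix_(i, j) Complex (rsum (fun k => complex.Re (X k i j)))
                         (rsum (fun k => complex.Im (X k i j))).

Definition density (C : numClosedFieldType) (n : nat) (X : 'M[C]_n) : Prop :=
  (forall u : 'rV[C]_n, 0 <= (u *m X *m u^t*) 0 0) /\ \tr X = 1.

(* (C^2)^{(x) n} has the product basis n.-tuple 'I_2; operators on it are     *)
(* matrices indexed through enum_rank / enum_val.                             *)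
Notation qdim n := #|{: n.-tuple 'I_2}|.

Definition bidx (n m : nat) (x : n.-tuple 'I_2) (y : m.-tuple 'I_2) :
    'I_(qdim n * qdim m) :=
  mxtens_index (enum_rank x, enum_rank y).

Definition tensor_family (C : numClosedFieldType) (n : nat)
    (F : 'I_n -> 'M[C]_2) : 'M[C]_(qdim n) :=
  \matrix_(x, y) \prod_(k < n) F k (tnth (enum_val x) k) (tnth (enum_val y) k).

Definition factor_perm (C : numClosedFieldType) (n : nat) (s : 'S_n) :
    'M[C]_(qdim n) :=
  \matrix_(x, y)
    (enum_val y == [tuple tnth (enum_val x) (s k) | k < n])%:R.

(* Sym^n(C^2), as a row space: the vectors fixed by all permutations of the   *)
(* tensor factors.                                                            *)
Definition symspace (C : numClosedFieldType) (n : nat) : 'M[C]_(qdim n) :=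
  (\bigcap_(s : 'S_n) eigenspace (factor_perm C s) 1)%MS.

(* The block with index (n, m) has n.+1 photons on the first side and m.+1 on *)
(* the second. The row space of U *t V is the tensor product of those of U    *)
(* and V.                                                                     *)
Record multiphoton_state (R : realType) := MultiphotonState {
  weight : nat * nat -> R;
  block : forall n m : nat, 'M[R[i]]_(qdim n.+1 * qdim m.+1);
  weight_ge0 : forall k, 0 <= weight k;
  weight_sum1 : (\esum_(k in [set: nat * nat]) (weight k)%:E = 1)%E;
  block_density : forall n m, density (block n m);
  block_sym : forall n m,
    (block n m <= symspace R[i] n.+1 *t symspace R[i] m.+1)%MS }.

(* Lambda_{n+1 -> 1} (x) Lambda_{m+1 -> 1}: partial trace over all tensor     *)
(* factors but the first one of each side.                                    *)
Definition universal_squash (C : numClosedFieldType) (n m : nat)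
    (X : 'M[C]_(qdim n.+1 * qdim m.+1)) : 'M[C]_(2 * 2) :=
  \matrix_(i, j)
    \sum_(z : n.-tuple 'I_2) \sum_(w : m.-tuple 'I_2)
      X (bidx [tuple of (mxtens_unindex i).1 :: z]
              [tuple of (mxtens_unindex i).2 :: w])
        (bidx [tuple of (mxtens_unindex j).1 :: z]
              [tuple of (mxtens_unindex j).2 :: w]).

Definition effective (R : realType) (rho : multiphoton_state R) :
    'M[R[i]]_(2 * 2) :=
  mxrsum (fun k : nat * nat =>
    ((weight rho k)%:C)%C *: universal_squash (block rho k.1 k.2)).

Definition pm1_observable (C : numClosedFieldType) (A : 'M[C]_2) : Prop :=
  [/\ A \is hermsymmx, eigenvalue A 1 & eigenvalue A (-1)].

(* Outcomes are encoded as booleans: true is +1 and false is -1. *)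
Definition outcome_proj (C : numClosedFieldType) (A : 'M[C]_2) (s : bool) :
    'M[C]_2 :=
  proj_ortho (eigenspace A (if s then 1 else -1)).

(* Born probability that the photons of the first side give the outcomes a    *)
(* and those of the second side the outcomes b.                               *)
Definition outcome_prob (R : realType) (A B : 'M[R[i]]_2) (n m : nat)
    (X : 'M[R[i]]_(qdim n * qdim m)) (a : n.-tuple bool) (b : m.-tuple bool) :
    R :=
  complex.Re (\tr (X *m (tensor_family (fun k => outcome_proj A (tnth a k))
                      *t tensor_family (fun k => outcome_proj B (tnth b k))))).

Definition event_prob (R : realType) (rho : multiphoton_state R)
    (A B : 'M[R[i]]_2) (E : seq bool -> seq bool -> bool) : R :=
  rsum (fun k : nat * nat => weight rho k *
    \sum_(a : k.1.+1.-tuple bool) \sum_(b : k.2.+1.-tuple bool | E a b)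
      outcome_prob A B (block rho k.1 k.2) a b).

Definition single_click (s : bool) (a : seq bool) : bool := all (pred1 s) a.

Definition double_click (a : seq bool) : bool := (true \in a) && (false \in a).

Definition P_single_plus (R : realType) (rho : multiphoton_state R)
    (A B : 'M[R[i]]_2) : R :=
  event_prob rho A B
    (fun a b => [exists s : bool, single_click s a && single_click s b]).

Definition P_single_minus (R : realType) (rho : multiphoton_state R)
    (A B : 'M[R[i]]_2) : R :=
  event_prob rho A B
    (fun a b => [exists s : bool, single_click s a && single_click (~~ s) b]).

Definition P_double (R : realType) (rho : multiphoton_state R)
    (A B : 'M[R[i]]_2) : R :=
  event_prob rho A B (fun a b => double_click a || double_click b).

Definition ptrace_snd (C : numClosedFieldType) (m n : nat)
    (X : 'M[C]_(m * n)) : 'M[C]_m :=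
  \matrix_(i, j) \sum_(k < n) X (mxtens_index (i, k)) (mxtens_index (j, k)).

Definition ptrace_fst (C : numClosedFieldType) (m n : nat)
    (X : 'M[C]_(m * n)) : 'M[C]_n :=
  \matrix_(i, j) \sum_(k < m) X (mxtens_index (k, i)) (mxtens_index (k, j)).

(* A unit vector is maximally entangled when both of its reduced states are   *)
(* maximally mixed.                                                           *)
Definition max_entangled (C : numClosedFieldType) (Phi : 'rV[C]_(2 * 2)) :
    Prop :=
  [/\ Phi *m Phi^t* = 1%:M,
      ptrace_snd (Phi^t* *m Phi) = (2^-1)%:M &
      ptrace_fst (Phi^t* *m Phi) = (2^-1)%:M].

(* The supremum is a maximum: the maximally entangled unit vectors form a     *)
(* compact set.                                                               *)
Definition fidelity (R : realType) (sigma : 'M[R[i]]_(2 * 2)) : R :=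
  sup [set complex.Re ((Phi *m sigma *m Phi^t*) 0 0)
      | Phi in [set Phi : 'rV[R[i]]_(2 * 2) | max_entangled Phi]].

(* Main.v *)
(* Only the first photon of each side enters sigma, and its outcomes have the
   sign product of the single clicks whenever both sides have one; each block
   thus contributes to E[A_i B_j] its single-click terms up to at most the
   double-click probability.

   For the fidelity, write two-qubit vectors in the magic basis: the maximally
   entangled vectors are the real ones (up to a phase), i.e. unit quaternions,
   and A (x) B acts on quaternions by a left and a right multiplication. The
   CHSH operator becomes a real symmetric 4x4 matrix S, and the real part G of
   sigma satisfies 0 <= G <= F. Anticommutation gives (S^2 - 4)^2 = k^2 with
   0 <= k <= 4, so S has the eigenvalues +-l1 and +-l2 with l1^2 = 4 + k and
   l2^2 = 4 - k. If k > 0, the eigenprojector of l1 has trace one, its weight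
   in G is at most F, hence chi <= l2 + F (l1 - l2), and Cauchy-Schwarz with
   l1^2 + l2^2 = 8 finishes the proof; if k = 0, then S^2 = 4 and chi <= 2. *)

Require Import Defs.
From mathcomp Require Import all_boot all_order all_algebra.
From mathcomp Require Import all_classical all_reals all_analysis.
From mathcomp Require Import ring lra.

Set Implicit Arguments.
Unset Strict Implicit.
Unset Printing Implicit Defensive.

Import Order.TTheory GRing.Theory Num.Theory.

Local Open Scope classical_set_scope.
Local Open Scope sesquilinear_scope.
Local Open Scope ring_scope.
Local Open Scope complex_scope.

(** * Unordered sums of summable real families *)

Section RealSums.
Context {R : realType} {I : choiceType}.
Implicit Types f g : I -> R.

Definition rsummable f : Prop := summable [set: I] (EFin \o f).

Lemma rsummableD f g :
  rsummable f -> rsummable g -> rsummable (fun k => f k + g k).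
Proof. by move=> sf sg; have := summableD sf sg. Qed.

Lemma rsummableN f : rsummable f -> rsummable (fun k => - f k).
Proof. by rewrite /rsummable summableN. Qed.

Lemma rsummable_le f g :
  (forall k, `|f k| <= g k) -> rsummable g -> rsummable f.
Proof.
move=> fg; apply: le_lt_trans; apply: le_esum => k _ /=.
by rewrite lee_fin (le_trans (fg k)) // ler_norm.
Qed.

(** One half of the scaling law; [esumZ] obtains the other by applying it to [c^-1]. *)
Lemma esumZ_le (c : R) (a : I -> \bar R) : 0 <= c ->
  (forall k, (0 <= a k)%E) ->
  (\esum_(k in [set: I]) (c%:E * a k) <= c%:E * \esum_(k in [set: I]) a k)%E.
Proof.
move=> c0 a0; apply: ge_ereal_sup => _ [X [finX XI]] <-.
rewrite -ge0_mule_fsumr//; apply: lee_wpmul2l; rewrite ?lee_fin//.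
by apply: ereal_sup_ubound; exists X.
Qed.

Lemma esumZ (c : R) (a : I -> \bar R) : 0 <= c ->
  (forall k, (0 <= a k)%E) ->
  (\esum_(k in [set: I]) (c%:E * a k) = c%:E * \esum_(k in [set: I]) a k)%E.
Proof.
move=> c0 a0; apply/eqP; rewrite eq_le esumZ_le //=.
have [->|cn0] := eqVneq c 0.
  by rewrite mul0e esum_ge0// => k _; rewrite mul0e.
have {cn0}c0 : 0 < c by rewrite lt_def cn0.
rewrite -lee_pdivlMl//.
apply: le_trans (@esumZ_le c^-1 (fun k => c%:E * a k)%E _ _); first last.
- by move=> k; rewrite mule_ge0// lee_fin ltW.
- by rewrite invr_ge0 ltW.
by apply: le_esum => k _; rewrite muleA -EFinM mulVf ?gt_eqF// mul1e.
Qed.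

Lemma rsummableZ c f : rsummable f -> rsummable (fun k => c * f k).
Proof.
move=> sf; rewrite /rsummable /summable.
rewrite (eq_esum (b := fun k => `|c|%:E * `|(EFin \o f) k|)%E); last first.
  by move=> k _ /=; rewrite normrM EFinM.
rewrite esumZ//.
move: sf; rewrite /rsummable summableE => /fineK <-.
by rewrite -EFinM ltry.
Qed.

Lemma rsummable_pos f : rsummable f -> rsummable (fun k => Num.max (f k) 0).
Proof.
move=> sf; apply: (@rsummable_le _ (fun k => `|f k|)).
  by move=> k; case: (leP 0 (f k)) => h; rewrite ?normr0 // max_l.
by move: sf; rewrite /rsummable /summable /=;
  under [X in (_ -> X < _)%E]eq_esum do rewrite normr_id.
Qed.

Let S f : R := fine (\esum_(k in [set: I]) (f k)%:E).

Let fin f : rsummable f -> (forall k, 0 <= f k) ->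
  (\esum_(k in [set: I]) (f k)%:E)%E \is a fin_num.
Proof.
move=> sh h0; move: sh; rewrite /rsummable summableE.
by under eq_esum do rewrite /= ger0_norm//.
Qed.

Let SD f g : rsummable f -> rsummable g ->
  (forall k, 0 <= f k) -> (forall k, 0 <= g k) ->
  S (fun k => f k + g k) = S f + S g.
Proof.
move=> sf sg f0 g0; rewrite /S -fineD ?fin// -esumD//.
by move=> k _; rewrite lee_fin.
by move=> k _; rewrite lee_fin.
Qed.

(** The value does not depend on how a family is split into nonnegative parts:
    [max(f - g, 0) + g = max(g - f, 0) + f], and both sides are sums of nonnegative families, to
    which additivity applies. *)
Lemma rsumB f g : rsummable f -> rsummable g ->
  (forall k, 0 <= f k) -> (forall k, 0 <= g k) ->
  rsum (fun k => f k - g k) = S f - S g.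
Proof.
move=> sf sg f0 g0; rewrite /rsum -!/(S _).
have sfg := rsummableD sf (rsummableN sg).
have sgf := rsummableN sfg.
have m0 (x : R) : 0 <= Num.max x 0 by rewrite le_max lexx orbT.
have eqS : S (fun k => Num.max (f k - g k) 0 + g k)
         = S (fun k => Num.max (- (f k - g k)) 0 + f k).
  congr S; apply: funext => k.
  by case: (leP 0 (f k - g k)) => h; case: (leP 0 (- (f k - g k))) => h'; lra.
rewrite (SD (rsummable_pos sfg) sg (fun=> m0 _) g0) in eqS.
rewrite (SD (rsummable_pos sgf) sf (fun=> m0 _) f0) in eqS.
lra.
Qed.

Lemma posneg (x : R) : x = Num.max x 0 - Num.max (- x) 0.
Proof. by case: (leP 0 x) => h; case: (leP 0 (- x)) => h'; lra. Qed.

Lemma rsumN f : rsum (fun k => - f k) = - rsum f.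
Proof.
rewrite /rsum opprB; congr (_ - fine _).
by apply: eq_esum => k _; rewrite opprK.
Qed.

Lemma rsumD f g : rsummable f -> rsummable g ->
  rsum (fun k => f k + g k) = rsum f + rsum g.
Proof.
move=> sf sg.
(* Positive and negative parts are grouped separately, which is a splitting as in [rsumB], though
   not the canonical one. *)
have -> : (fun k => f k + g k) =
  (fun k => (Num.max (f k) 0 + Num.max (g k) 0)
          - (Num.max (- f k) 0 + Num.max (- g k) 0)).
  apply: funext => k; rewrite {1}(posneg (f k)) {1}(posneg (g k)); ring.
have m0 (x : R) : 0 <= Num.max x 0 by rewrite le_max lexx orbT.
have sp := rsummable_pos sf; have sq := rsummable_pos sg.
have sp' := rsummable_pos (rsummableN sf).
have sq' := rsummable_pos (rsummableN sg).
rewrite (rsumB (rsummableD sp sq) (rsummableD sp' sq')).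
- rewrite (SD sp sq (fun=> m0 _) (fun=> m0 _)).
  rewrite (SD sp' sq' (fun=> m0 _) (fun=> m0 _)) /rsum /S; ring.
- by move=> k; rewrite addr_ge0// m0.
- by move=> k; rewrite addr_ge0// m0.
Qed.

Lemma rsumZ c f : rsummable f -> rsum (fun k => c * f k) = c * rsum f.
Proof.
wlog c0 : c / 0 <= c => [hw sf|sf].
  case: (leP 0 c) => [/hw|c0]; first exact.
  have := hw (- c); rewrite oppr_ge0 ltW// => /(_ isT sf) h.
  apply: oppr_inj; rewrite -rsumN -mulNr -h.
  by congr rsum; apply: funext => k; ring.
rewrite /rsum mulrBr; congr (_ - _).
  under eq_esum do rewrite -{1}(mulr0 c) -maxr_pMr// EFinM.
  rewrite esumZ ?fineM// ?fin//.
  - exact: rsummable_pos.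
  - by move=> k; rewrite le_max lexx orbT.
  - by move=> k; rewrite lee_fin le_max lexx orbT.
under eq_esum do rewrite -mulrN -{1}(mulr0 c) -maxr_pMr// EFinM.
rewrite esumZ ?fineM// ?fin//.
- exact/rsummable_pos/rsummableN.
- by move=> k; rewrite le_max lexx orbT.
- by move=> k; rewrite lee_fin le_max lexx orbT.
Qed.

Lemma rsum_ge0 f : (forall k, 0 <= f k) -> 0 <= rsum f.
Proof.
move=> f0; rewrite /rsum [X in _ - fine X]esum1 ?subr0.
  by apply: fine_ge0; apply: esum_ge0 => k _; rewrite lee_fin le_max lexx orbT.
by move=> k _; rewrite max_r// oppr_le0.
Qed.

Lemma ler_rsum f g : rsummable f -> rsummable g ->
  (forall k, f k <= g k) -> rsum f <= rsum g.
Proof.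
move=> sf sg fg; rewrite -subr_ge0 -rsumN -rsumD//; last exact: rsummableN.
by apply: rsum_ge0 => k; rewrite subr_ge0.
Qed.

Lemma rsum_sum (J : finType) (F : J -> I -> R) :
  (forall j, rsummable (F j)) ->
  rsummable (fun k => \sum_j F j k)
  /\ rsum (fun k => \sum_j F j k) = \sum_j rsum (F j).
Proof.
move=> sF.
have s0 : rsummable (fun=> 0).
  rewrite /rsummable /summable esum1 ?ltry//.
  by move=> k _ /=; rewrite normr0.
have rsum0 : rsum (fun _ : I => 0) = 0 :> R.
  rewrite -[RHS](mul0r (rsum (fun _ : I => 0))) -rsumZ//.
  by congr rsum; apply: funext => k; rewrite mul0r.
elim: (index_enum J) => [|j r [sr IH]].
  by split; under eq_fun do rewrite big_nil; rewrite // big_nil.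
split; first by under eq_fun do rewrite big_cons; exact: rsummableD.
by under eq_fun do rewrite big_cons; rewrite big_cons rsumD// IH.
Qed.

End RealSums.

(** * Qubit observables and their outcome projectors *)

Section Observables.
Context {R : realType}.
Local Notation C := R[i].
Implicit Types (A : 'M[C]_2) (s : bool).

(** The combination of the three Pauli matrices with Bloch vector [(x, y, z)]. *)
Definition pauli (x y z : R) : 'M[C]_2 :=
  \matrix_(i, j) if i == 0 then (if j == 0 then z%:C else x -i* y)
                 else (if j == 0 then x +i* y else (- z)%:C).

(* The conjugation of the [numClosedFieldType] structure of [R[i]] is obtained
   abstractly and does not reduce to [conjc]. *)
Lemma conjCE (z : C) : Num.conj z = conjc z.
Proof.
have [->|z0] := eqVneq z 0; first by rewrite rmorph0 conjc0.
by apply: (mulfI z0); rewrite -normCK sqr_normc.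
Qed.

Lemma matrix2P (T : Type) (M N : 'M[T]_2) :
  M 0 0 = N 0 0 -> M 0 1 = N 0 1 -> M 1 0 = N 1 0 -> M 1 1 = N 1 1 -> M = N.
Proof.
move=> e00 e01 e10 e11; apply/matrixP => i j.
have ord2 (k : 'I_2) : k = 0 \/ k = 1.
  by case: k => -[|[|//]] h; [left|right]; exact/val_inj.
by case: (ord2 i) => ->; case: (ord2 j) => ->.
Qed.

(** The vanishing of the characteristic determinant, written out for a 2x2 matrix. *)
Lemma eigenvalue2 A a : eigenvalue A a ->
  (A 0 0 - a) * (A 1 1 - a) = A 0 1 * A 1 0.
Proof.
case/eigenvalueP => u uA u0.
have uA0 : u *m (A - a%:M) = 0 by rewrite mulmxBr uA mul_mx_scalar subrr.
have /eqP : \det (A - a%:M) = 0 by apply/eqP/det0P; exists u.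
rewrite (expand_det_row _ 0) big_ord_recl big_ord1 /cofactor !det_mx11 !mxE /=.
rewrite /bump /= expr0 expr1 !mul1r !mulN1r mulrN subr_eq0 mulr1n mulr0n !subr0.
have -> : lift 0 0 = 1 :> 'I_2 by apply: val_inj.
have -> : lift 1 0 = 0 :> 'I_2 by apply: val_inj.
by move=> /eqP.
Qed.

(** Subtracting the characteristic equations at [1] and [-1] shows that the trace vanishes.
    Hermiticity leaves three real parameters, and the equation at [1] puts them on the unit
    sphere. *)
Lemma pm1_pauli A : pm1_observable A ->
  exists x y z : R, x ^+ 2 + y ^+ 2 + z ^+ 2 = 1 /\ A = pauli x y z.
Proof.
case=> /is_hermitianmxP; rewrite expr0 scale1r => hA.
move=> /eigenvalue2 e1 /eigenvalue2 e2.
have hE i j : A i j = conjc (A j i) by rewrite {1}hA !mxE conjCE.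
have tr0 : A 1 1 = - A 0 0.
  have : (A 0 0 - 1) * (A 1 1 - 1) = (A 0 0 - -1) * (A 1 1 - -1) by rewrite e1 e2.
  move=> h; apply/eqP; rewrite -addr_eq0 -(mulrI_eq0 _ (mulfI (x := 2) _))//.
  suff -> : 2 * (A 1 1 + A 0 0)
    = (A 0 0 - -1) * (A 1 1 - -1) - (A 0 0 - 1) * (A 1 1 - 1) by rewrite h subrr.
  ring.
move: (hE 0 0) (hE 1 0) e1; rewrite tr0.
case e00: (A 0 0) => [z z']; case e01: (A 0 1) => [x y].
move=> [z'0] e10; rewrite e10 /=.
have {z'0}z'0 : z' = 0 by lra.
move=> [e _]; exists x, (- y), z; split; first by move: e; rewrite z'0; lra.
apply: matrix2P; rewrite !mxE /= ?tr0 ?e00 ?e01 ?e10 ?z'0 //= ?opprK //.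
by apply/eqP; rewrite eq_complex /= oppr0 !eqxx.
Qed.

Lemma pauli_sq x y z : x ^+ 2 + y ^+ 2 + z ^+ 2 = 1 ->
  pauli x y z *m pauli x y z = 1%:M.
Proof.
move=> h; apply: matrix2P; rewrite !mxE !big_ord_recl big_ord0 !mxE /=;
  simpc; congr (_ +i* _); lra.
Qed.

Lemma pauli_herm x y z : (pauli x y z)^t* = pauli x y z.
Proof.
by apply: matrix2P; rewrite !mxE /= conjCE /= ?opprK ?oppr0.
Qed.

Lemma pm1_sq A : pm1_observable A -> A *m A = 1%:M.
Proof. by move=> /pm1_pauli[x [y [z [h ->]]]]; exact: pauli_sq. Qed.

Lemma pm1_herm A : pm1_observable A -> A^t* = A.
Proof. by move=> /pm1_pauli[x [y [z [_ ->]]]]; exact: pauli_herm. Qed.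

Definition sign_of s : C := if s then 1 else -1.

Lemma scale_half (M : 'M[C]_2) : 2^-1 *: (M + M) = M.
Proof.
by rewrite -mulr2n -(scaler_nat 2 M) scalerA mulVf ?scale1r// pnatr_eq0.
Qed.

(** By [A *m A = 1] the right-hand side [Q] maps into the eigenspace, and since [A] is hermitian
    [1 - Q] maps into its orthogonal complement; these two facts determine the orthogonal
    projector. *)
Lemma outcome_projE A s : pm1_observable A ->
  outcome_proj A s = 2^-1 *: (1%:M + sign_of s *: A).
Proof.
move=> hA; have A2 := pm1_sq hA; have Ah := pm1_herm hA.
set Q := RHS; rewrite /outcome_proj -/(sign_of s).
set c := sign_of s in Q *.
have cc : c * c = 1 by rewrite /c /sign_of; case: (s); rewrite ?mulrNN mul1r.
have conjc_c : (c^*)%R = c.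
  by rewrite /c /sign_of; case: (s); rewrite ?rmorphN rmorph1.
have QE : (Q <= eigenspace A c)%MS.
  apply/eigenspaceP; rewrite /Q -scalemxAl mulmxDl mul1mx -scalemxAl A2.
  rewrite [RHS]scalerA [c * _]mulrC -scalerA; congr (_ *: _).
  by rewrite scalerDr scalerA cc scale1r addrC.
have Q1 : 1%:M - Q = 2^-1 *: (1%:M - c *: A).
  rewrite -[X in X - _](scale_half 1%:M) /Q -scalerBr; congr (_ *: _).
  by rewrite opprD addrACA subrr add0r.
have Qo : (1%:M - Q <= orthomx Num.conj (mx_of_hermitian (hermitian1mx _))
                          (eigenspace A c))%MS.
  apply/orthomx1P; rewrite Q1.
  have /eigenspaceP EA : (eigenspace A c <= eigenspace A c)%MS by [].
  have hE : A *m (eigenspace A c)^t* = c *: (eigenspace A c)^t*.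
    rewrite -[X in X *m _]Ah -map_mxM -trmx_mul EA.
    by rewrite linearZ /= map_mxZ /= conjc_c.
  rewrite -scalemxAl mulmxBl mul1mx -scalemxAl hE scalerA cc scale1r subrr.
  by rewrite scaler0.
rewrite -[LHS]mul1mx -[X in X *m _](subrK Q) mulmxDl.
by rewrite (proj_ortho_0 Qo) add0r (proj_ortho_id QE).
Qed.

Lemma outcome_proj_herm A s : pm1_observable A ->
  (outcome_proj A s)^t* = outcome_proj A s.
Proof.
move=> hA; rewrite outcome_projE// linearZ /= map_mxZ linearD /= map_mxD.
rewrite linearZ /= map_mxZ (pm1_herm hA) trmx1 map_mx1.
rewrite fmorphV rmorph_nat /sign_of; congr (_ *: (_ + _ *: _)).
by case: s; rewrite ?rmorphN rmorph1.
Qed.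

Lemma outcome_proj_idem A s :
  outcome_proj A s *m outcome_proj A s = outcome_proj A s.
Proof. exact: proj_ortho_proj. Qed.

Lemma outcome_proj_sum A : pm1_observable A ->
  \sum_s outcome_proj A s = 1%:M.
Proof.
move=> hA; rewrite big_bool /= !outcome_projE// -scalerDr /sign_of.
rewrite scaleN1r scale1r addrACA subrr addr0.
exact: scale_half.
Qed.

Lemma outcome_proj_mean A : pm1_observable A ->
  \sum_s sign_of s *: outcome_proj A s = A.
Proof.
move=> hA; rewrite big_bool /= !outcome_projE// /sign_of !scale1r !scaleN1r.
rewrite -scalerN -scalerDr opprD opprK addrACA subrr add0r.
exact: scale_half.
Qed.

End Observables.

(** * Positive semidefinite matrices *)

Section PositiveMatrices.
Context {C : numClosedFieldType}.

Lemma adjmxM m n p (A : 'M[C]_(m, n)) (B : 'M[C]_(n, p)) :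
  (A *m B)^t* = B^t* *m A^t*.
Proof. by rewrite trmx_mul map_mxM. Qed.

Lemma adjmx_tens m n p q (A : 'M[C]_(m, n)) (B : 'M[C]_(p, q)) :
  (A *t B)^t* = A^t* *t B^t*.
Proof. by rewrite trmx_tens map_mxT. Qed.

Definition psdmx n (X : 'M[C]_n) :=
  forall u : 'rV[C]_n, 0 <= (u *m X *m u^t*) 0 0.

Lemma psdmx_conj m n (X : 'M[C]_n) (K : 'M[C]_(m, n)) :
  psdmx X -> psdmx (K *m X *m K^t*).
Proof.
by move=> hX u; rewrite !mulmxA -[_ *m K^t* *m u^t*]mulmxA -adjmxM; exact: hX.
Qed.

Lemma psdmx_sum n (I : finType) (F : I -> 'M[C]_n) :
  (forall i, psdmx (F i)) -> psdmx (\sum_i F i).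
Proof.
move=> hF u; rewrite mulmx_sumr mulmx_suml summxE.
by apply: sumr_ge0 => i _; exact: hF.
Qed.

Lemma psdmx_diag n (X : 'M[C]_n) i : psdmx X -> 0 <= X i i.
Proof.
move=> /(_ (delta_mx 0 i)); rewrite -rowE trmx_delta map_delta_mx -colE.
by rewrite !mxE.
Qed.

Lemma psdmx_trace n (X : 'M[C]_n) : psdmx X -> 0 <= \tr X.
Proof. by move=> hX; apply: sumr_ge0 => i _; exact: psdmx_diag. Qed.

(** Idempotence and cyclicity turn the trace into that of the conjugate [P X P^*], which is
    positive. *)
Lemma psdmx_trace_proj n (X P : 'M[C]_n) :
  psdmx X -> P^t* = P -> P *m P = P -> 0 <= \tr (X *m P).
Proof.
move=> hX Ph PP; rewrite -PP mulmxA mxtrace_mulC mulmxA -{2}Ph.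
exact/psdmx_trace/psdmx_conj.
Qed.

(** The quadratic form at [e_i + c e_j]. With [c] a fourth root of unity it controls the
    off-diagonal entries in [density_entries]. *)
Lemma psdmx_form n (X : 'M[C]_n) i j (c : C) : psdmx X ->
  0 <= X i i + c^* * X i j + c * X j i + `|c| ^+ 2 * X j j.
Proof.
move=> /(_ (delta_mx 0 i + c *: delta_mx 0 j)).
rewrite linearD linearZ /= map_mxD map_mxZ /= !trmx_delta !map_delta_mx.
rewrite mulmxDl mulmxDr !mulmxDl -!scalemxAl -!scalemxAr -!rowE -!colE !mxE.
by rewrite normCK; congr (_ <= _); ring.
Qed.

End PositiveMatrices.

(** * Operators that are products over the tensor factors *)

Section TensorFamilies.
Context {C : numClosedFieldType}.

Lemma prod_sum_tuple (T : finType) n (F : 'I_n -> T -> C) :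
  \prod_k \sum_t F k t = \sum_(x : n.-tuple T) \prod_k F k (tnth x k).
Proof.
rewrite bigA_distr_bigA /=.
rewrite (reindex (fun x : n.-tuple T => [ffun k => tnth x k])) /=.
  by apply: eq_bigr => x _; apply: eq_bigr => k _; rewrite ffunE.
exists (fun f : {ffun 'I_n -> T} => [tuple f k | k < n]) => [x|f] _.
  by apply: eq_from_tnth => k; rewrite tnth_mktuple ffunE.
by apply/ffunP => k; rewrite ffunE tnth_mktuple.
Qed.

Lemma sum_enum_rank (V : nmodType) (T : finType) (F : 'I_#|T| -> V) :
  \sum_i F i = \sum_(x : T) F (enum_rank x).
Proof. by rewrite (reindex _ (onW_bij _ (enum_rank_bij T))). Qed.

Lemma sum_tuple_cons (V : nmodType) (T : finType) n (F : n.+1.-tuple T -> V) :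
  \sum_x F x = \sum_t \sum_(z : n.-tuple T) F [tuple of t :: z].
Proof.
rewrite pair_big /=.
rewrite (reindex (fun p : T * n.-tuple T => [tuple of p.1 :: p.2])) //=.
exists (fun x : n.+1.-tuple T => (thead x, [tuple of behead x]))
  => [[t z]|x] _ /=.
  by rewrite theadE; congr (_, _); apply: val_inj.
by rewrite [x in RHS]tuple_eta.
Qed.

Lemma sum_mxtens (V : nmodType) m n (F : 'I_(m * n) -> V) :
  \sum_p F p = \sum_i \sum_j F (mxtens_index (i, j)).
Proof.
rewrite pair_big /=.
rewrite (reindex (@mxtens_index m n)) /=; first by apply: eq_bigr => -[].
exists (@mxtens_unindex m n) => p _.
  exact: mxtens_indexK.
exact: mxtens_unindexK.
Qed.

Lemma tensor_familyE n (F : 'I_n -> 'M[C]_2) (x y : n.-tuple 'I_2) :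
  tensor_family F (enum_rank x) (enum_rank y)
  = \prod_(k < n) F k (tnth x k) (tnth y k).
Proof. by rewrite mxE !enum_rankK. Qed.

Lemma matrix_rankP n (M N : 'M[C]_(qdim n)) :
  (forall x y : n.-tuple 'I_2,
      M (enum_rank x) (enum_rank y) = N (enum_rank x) (enum_rank y)) -> M = N.
Proof.
move=> h; apply/matrixP => i j.
by rewrite -(enum_valK i) -(enum_valK j).
Qed.

Lemma tensor_familyM n (F G : 'I_n -> 'M[C]_2) :
  tensor_family F *m tensor_family G = tensor_family (fun k => F k *m G k).
Proof.
apply: matrix_rankP => x y; rewrite tensor_familyE mxE sum_enum_rank.
under [RHS]eq_bigr do rewrite mxE.
rewrite prod_sum_tuple; apply: eq_bigr => z _.
by rewrite !tensor_familyE big_split.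
Qed.

Lemma tensor_family_adj n (F : 'I_n -> 'M[C]_2) :
  (tensor_family F)^t* = tensor_family (fun k => (F k)^t*).
Proof.
apply: matrix_rankP => x y; rewrite !mxE !enum_rankK rmorph_prod.
by apply: eq_bigr => k _; rewrite !mxE.
Qed.

Lemma eq_tensor_family n (F G : 'I_n -> 'M[C]_2) :
  F =1 G -> tensor_family F = tensor_family G.
Proof.
move=> FG; apply: matrix_rankP => x y; rewrite !tensor_familyE.
by apply: eq_bigr => k _; rewrite FG.
Qed.

(** Distributivity, entry by entry. Weights [1] will give the completeness of a product measurement;
    signs on the first factor alone will give the observable of the first photon. *)
Lemma tensor_family_sum (T : finType) n (c : 'I_n -> T -> C) (P : T -> 'M[C]_2) :
  \sum_(a : n.-tuple T) (\prod_k c k (tnth a k)) *: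
      tensor_family (fun k => P (tnth a k))
  = tensor_family (fun k => \sum_t c k t *: P t).
Proof.
apply: matrix_rankP => x y; rewrite tensor_familyE summxE.
under [RHS]eq_bigr do rewrite summxE.
rewrite prod_sum_tuple; apply: eq_bigr => a _.
rewrite mxE tensor_familyE -big_split; apply: eq_bigr => k _.
by rewrite mxE.
Qed.

Definition on_first n (A : 'M[C]_2) : 'I_n.+1 -> 'M[C]_2 :=
  fun k => if k == ord0 then A else 1%:M.

Lemma prod_eq_tuple (T : eqType) n (x y : n.-tuple T) :
  \prod_k (tnth x k == tnth y k)%:R = (x == y)%:R :> C.
Proof.
have [->|xy] := eqVneq x y; first by rewrite big1// => k _; rewrite eqxx.
have [k xyk] : exists k, tnth x k != tnth y k.
  apply/existsP; apply: contraNT xy; rewrite negb_exists => /forallP h.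
  by apply/eqP/eq_from_tnth => k; apply/eqP; rewrite -[_ == _]negbK.
by rewrite (bigD1 k) //= (negbTE xyk) mul0r.
Qed.

Lemma tensor_family1 n : tensor_family (fun _ : 'I_n => 1%:M) = 1%:M :> 'M[C]__.
Proof.
apply: matrix_rankP => x y; rewrite tensor_familyE mxE.
rewrite (inj_eq enum_rank_inj) -prod_eq_tuple.
by apply: eq_bigr => k _; rewrite mxE.
Qed.

Lemma tensmx11 m n : 1%:M *t 1%:M = 1%:M :> 'M[C]_(m * n).
Proof.
apply/matrixP => p q.
case: (mxtens_indexP p) => i j; case: (mxtens_indexP q) => k l.
rewrite tensmxE !mxE (inj_eq (can_inj (@mxtens_indexK m n))) xpair_eqE.
by rewrite -natrM mulnb.
Qed.

Lemma tensor_on_first n (A : 'M[C]_2) i j (x y : n.-tuple 'I_2) :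
  tensor_family (on_first A) (enum_rank [tuple of i :: x])
                             (enum_rank [tuple of j :: y])
  = A i j * (x == y)%:R.
Proof.
rewrite tensor_familyE big_ord_recl /on_first /=; congr (_ * _).
by rewrite -prod_eq_tuple; apply: eq_bigr => k _; rewrite !tnthS mxE.
Qed.

Lemma tensmx_suml (I J : finType) (c : I -> C) (d : J -> C) m n p q
    (M : I -> 'M[C]_(m, n)) (N : J -> 'M[C]_(p, q)) :
  (\sum_i c i *: M i) *t (\sum_j d j *: N j)
  = \sum_i \sum_j (c i * d j) *: (M i *t N j).
Proof.
apply/matrixP => k l; rewrite mxE !summxE mulr_suml; apply: eq_bigr => i _.
rewrite mulr_sumr summxE; apply: eq_bigr => j _; rewrite !mxE; ring.
Qed.

End TensorFamilies.

(** * The universal squash operation and its dual *)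

Section Squash.
Context {C : numClosedFieldType}.
Context {n m : nat}.
Implicit Types X : 'M[C]_(qdim n.+1 * qdim m.+1).

Definition squash_index (z : n.-tuple 'I_2) (w : m.-tuple 'I_2)
    (i : 'I_(2 * 2)) :=
  bidx [tuple of (mxtens_unindex i).1 :: z] [tuple of (mxtens_unindex i).2 :: w].

(** A Kraus decomposition: each pair of basis states of the discarded photons contributes one
    operator, a selection of rows of the identity. Positivity is immediate in this form. *)
Lemma universal_squash_kraus X :
  universal_squash X = \sum_z \sum_w
    rowsub (squash_index z w) 1%:M *m X *m (rowsub (squash_index z w) 1%:M)^t*.
Proof.
apply/matrixP => i j; rewrite mxE summxE; apply: eq_bigr => z _.
rewrite summxE; apply: eq_bigr => w _.
rewrite mul_rowsub_mx mul1mx trmx_mxsub map_mxsub trmx1 map_mx1.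
by rewrite mulmx_colsub mulmx1 !mxE.
Qed.

Lemma universal_squashE X i1 i2 j1 j2 :
  universal_squash X (mxtens_index (i1, i2)) (mxtens_index (j1, j2))
  = \sum_(z : n.-tuple 'I_2) \sum_(w : m.-tuple 'I_2)
      X (bidx [tuple of i1 :: z] [tuple of i2 :: w])
        (bidx [tuple of j1 :: z] [tuple of j2 :: w]).
Proof. by rewrite mxE !mxtens_indexK. Qed.

Lemma universal_squash_psd X : psdmx X -> psdmx (universal_squash X).
Proof.
move=> hX; rewrite universal_squash_kraus; apply: psdmx_sum => z.
by apply: psdmx_sum => w; exact: psdmx_conj.
Qed.

(** The dual of a partial trace pads an observable with identities on the discarded photons. *)
Lemma universal_squash_tens X (A B : 'M[C]_2) :
  \tr (universal_squash X *m (A *t B))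
  = \tr (X *m (tensor_family (on_first A) *t tensor_family (on_first B))).
Proof.
rewrite /mxtrace.
transitivity (\sum_i \sum_j universal_squash X i j * (A *t B) j i).
  by apply: eq_bigr => i _; rewrite mxE.
transitivity (\sum_p \sum_q X p q *
    (tensor_family (on_first A) *t tensor_family (on_first B)) q p); last first.
  by apply: eq_bigr => i _; rewrite mxE.
rewrite !sum_mxtens [RHS]sum_enum_rank sum_tuple_cons; apply: eq_bigr => i1 _.
under [RHS]eq_bigr do rewrite sum_enum_rank sum_tuple_cons.
rewrite [RHS]exchange_big /=; apply: eq_bigr => i2 _.
rewrite sum_mxtens.
under [LHS]eq_bigr => j1 _ do under eq_bigr => j2 _ do
  rewrite universal_squashE tensmxE mulr_suml.
under [LHS]eq_bigr => j1 _ do rewrite exchange_big /=.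
rewrite [LHS]exchange_big /=; apply: eq_bigr => z _.
under [LHS]eq_bigr => j1 _ do under eq_bigr => j2 _ do rewrite mulr_suml.
under [LHS]eq_bigr => j1 _ do rewrite exchange_big /=.
rewrite [LHS]exchange_big /=; apply: eq_bigr => w _.
rewrite sum_mxtens [RHS]sum_enum_rank sum_tuple_cons; apply: eq_bigr => j1 _.
(* The identity factors vanish unless the discarded digits agree, so only [z' = z] survives on the
   first side and [w' = w] on the second. *)
transitivity (\sum_(z' : n.-tuple 'I_2 | z' == z) \sum_(q < qdim m.+1)
    X (bidx [tuple of i1 :: z] [tuple of i2 :: w])
      (mxtens_index (enum_rank [tuple of j1 :: z'], q)) *
    (A j1 i1 * tensor_family (on_first B) q (enum_rank [tuple of i2 :: w]))).
  rewrite big_pred1_eq sum_enum_rank sum_tuple_cons; apply: eq_bigr => j2 _.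
  rewrite (bigD1 w) //= big1 ?addr0 => [|w' w'w].
    by rewrite tensor_on_first eqxx mulr1.
  by rewrite tensor_on_first (negbTE w'w) !mulr0.
rewrite big_mkcond; apply: eq_bigr => z' _; case: eqVneq => [->|zz'].
  by apply: eq_bigr => q _; rewrite tensmxE tensor_on_first eqxx mulr1.
rewrite big1// => q _.
by rewrite tensmxE tensor_on_first (negbTE zz') mulr0 mul0r mulr0.
Qed.

End Squash.

(** * Sums of complex and matrix-valued families *)

Section ComplexSums.
Context {R : realType} {I : choiceType}.
Implicit Types f g : I -> R[i].

Definition csummable f : Prop :=
  rsummable (fun k => complex.Re (f k)) /\ rsummable (fun k => complex.Im (f k)).

Definition csum f : R[i] :=
  rsum (fun k => complex.Re (f k)) +i* rsum (fun k => complex.Im (f k)).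

Lemma complex_ReM (x y : R[i]) : complex.Re (x * y) =
  complex.Re x * complex.Re y - complex.Im x * complex.Im y.
Proof. by case: x y => [a b] [c d]. Qed.

Lemma complex_ImM (x y : R[i]) : complex.Im (x * y) =
  complex.Re x * complex.Im y + complex.Im x * complex.Re y.
Proof. by case: x y => [a b] [c d]. Qed.

Lemma complex_Re_sum (J : finType) (F : J -> R[i]) :
  complex.Re (\sum_j F j) = \sum_j complex.Re (F j).
Proof. exact: (raddf_sum (@complex.Re R : Rcomplex R -> R)). Qed.

Lemma complex_Im_sum (J : finType) (F : J -> R[i]) :
  complex.Im (\sum_j F j) = \sum_j complex.Im (F j).
Proof. exact: (raddf_sum (@complex.Im R : Rcomplex R -> R)). Qed.

Lemma csumZ c f : csummable f ->
  csummable (fun k => c * f k) /\ csum (fun k => c * f k) = c * csum f.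
Proof.
case: c => a b [sRe sIm]; rewrite /csummable /csum.
under [fun k => complex.Re _]eq_fun do rewrite complex_ReM /=.
under [fun k => complex.Im _]eq_fun do rewrite complex_ImM /=.
have [sa sb] := (rsummableZ a sRe, rsummableZ b sIm).
have [sa' sb'] := (rsummableZ a sIm, rsummableZ b sRe).
split.
  by split; apply: rsummableD => //; exact: rsummableN.
rewrite !rsumD ?rsumN ?rsumZ//; exact: rsummableN.
Qed.

Lemma csum_sum (J : finType) (F : J -> I -> R[i]) :
  (forall j, csummable (F j)) ->
  csummable (fun k => \sum_j F j k)
  /\ csum (fun k => \sum_j F j k) = \sum_j csum (F j).
Proof.
move=> sF; rewrite /csummable /csum.
under [fun k => complex.Re _]eq_fun do rewrite complex_Re_sum /=.
under [fun k => complex.Im _]eq_fun do rewrite complex_Im_sum /=.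
have [sRe ->] := rsum_sum (fun j => (sF j).1).
have [sIm ->] := rsum_sum (fun j => (sF j).2).
split => //; apply/eqP; rewrite eq_complex.
rewrite complex_Re_sum.
by rewrite complex_Im_sum !eqxx.
Qed.

(** A trace against a fixed matrix is a finite linear combination of entries, hence commutes with
    the entrywise sum. *)
Lemma mxrsum_trace m n (F : I -> 'M[R[i]]_(m, n)) (M : 'M[R[i]]_(n, m)) :
  (forall i j, csummable (fun k => F k i j)) ->
  csummable (fun k => \tr (F k *m M)) /\
  \tr (mxrsum F *m M) = csum (fun k => \tr (F k *m M)).
Proof.
move=> sF.
have E (G : 'M[R[i]]_(m, n)) :
    \tr (G *m M) = \sum_(p : 'I_m * 'I_n) M p.2 p.1 * G p.1 p.2.
  rewrite -(pair_bigA _ (fun i j => M j i * G i j)) /=.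
  by apply: eq_bigr => i _; rewrite mxE; apply: eq_bigr => j _; rewrite mulrC.
under [fun k => \tr _]eq_fun do rewrite E.
have sZ (p : 'I_m * 'I_n) := csumZ (M p.2 p.1) (sF p.1 p.2).
have [s1 ->] := csum_sum (fun p => (sZ p).1); split => //.
by rewrite E; apply: eq_bigr => p _; rewrite (sZ p).2 mxE.
Qed.

Lemma csum_ge0 f : (forall k, 0 <= f k) -> 0 <= csum f.
Proof.
move=> f0; rewrite lecE /=; apply/andP; split.
  have -> : (fun k => complex.Im (f k)) = (fun k => - (0 : R)).
    by apply: funext => k; rewrite oppr0 ger0_Im.
  by rewrite /rsum !esum1 ?subrr// => k _; rewrite ?oppr0 ?opprK maxxx.
by apply: rsum_ge0 => k; have := f0 k; rewrite lecE => /andP[].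
Qed.

End ComplexSums.

(** * Entry bounds for density matrices *)

Section DensityEntries.
Context {R : realType}.

(** The forms at [e_i + c e_j] with [c = 1, -1, i, -i] are real, which relates the two off-diagonal
    entries by conjugation; their positivity bounds twice each part by [X i i + X j j], at most
    [2]. *)
Lemma density_entries n (X : 'M[R[i]]_n) i j : density X ->
  `|complex.Re (X i j)| <= 1 /\ `|complex.Im (X i j)| <= 1.
Proof.
case=> hX trX.
have d0 k : 0 <= X k k := psdmx_diag k hX.
have d1 k : X k k <= 1.
  by rewrite -trX /mxtrace (bigD1 k) //= lerDl; apply: sumr_ge0.
have f1 := psdmx_form i j 1 hX; have f2 := psdmx_form i j (-1) hX.
have f3 := psdmx_form i j (0 +i* 1) hX; have f4 := psdmx_form i j (0 +i* -1) hX.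
move: (d0 i) (d1 i) (d0 j) (d1 j) f1 f2 f3 f4; rewrite !sqr_normc !conjCE.
case: (X i i) (X j j) (X i j) (X j i) => [a a'] [b b'] [c c'] [e e'] /=.
rewrite !lecE /= => /andP[/eqP h1 h2] /andP[_ h3] /andP[/eqP h4 h5] /andP[_ h6].
move=> /andP[/eqP h7 h8] /andP[/eqP h9 h10].
move=> /andP[/eqP h11 h12] /andP[/eqP h13 h14].
split; rewrite ler_norml; apply/andP; split; lra.
Qed.

End DensityEntries.

(** * Outcome statistics of a single block *)

Section ThresholdDetection.
Context {R : realType}.
Local Notation C := R[i].
Variables A B : 'M[C]_2.
Hypotheses (hA : pm1_observable A) (hB : pm1_observable B).

Definition product_effect (O : 'M[C]_2) n (a : n.-tuple bool) : 'M[C]_(qdim n) :=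
  tensor_family (fun k => outcome_proj O (tnth a k)).

Lemma product_effect_herm O n (a : n.-tuple bool) : pm1_observable O ->
  (product_effect O a)^t* = product_effect O a.
Proof.
move=> hO; rewrite tensor_family_adj; apply: eq_tensor_family => k.
exact: outcome_proj_herm.
Qed.

Lemma product_effect_idem O n (a : n.-tuple bool) :
  product_effect O a *m product_effect O a = product_effect O a.
Proof.
rewrite tensor_familyM; apply: eq_tensor_family => k.
exact: outcome_proj_idem.
Qed.

Lemma product_effect_sum O n : pm1_observable O ->
  \sum_(a : n.-tuple bool) 1 *: product_effect O a = 1%:M.
Proof.
move=> hO; rewrite -tensor_family1.
rewrite (eq_tensor_family (G := fun k : 'I_n => \sum_s 1 *: outcome_proj O s)).
  rewrite -(tensor_family_sum (fun=> fun=> 1)); apply: eq_bigr => a _.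
  by rewrite big1.
by move=> k; under eq_bigr do rewrite scale1r; rewrite outcome_proj_sum.
Qed.

(** Factor [0] sums to the spectral decomposition of [O]; every other factor sums to the
    identity. *)
Lemma product_effect_mean O n : pm1_observable O ->
  \sum_(a : n.+1.-tuple bool) sign_of (thead a) *: product_effect O a
  = tensor_family (on_first O).
Proof.
move=> hO.
rewrite (eq_tensor_family (G := fun k : 'I_n.+1 =>
   \sum_s (if k == ord0 then sign_of s else 1) *: outcome_proj O s)).
  rewrite -tensor_family_sum; apply: eq_bigr => a _.
  by rewrite big_ord_recl /= big1 ?mulr1.
move=> k; rewrite /on_first; case: ifP => _; first by rewrite outcome_proj_mean.
by under eq_bigr do rewrite scale1r; rewrite outcome_proj_sum.
Qed.

Section Block.
Context {n m : nat}.
Variable X : 'M[C]_(qdim n.+1 * qdim m.+1).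
Hypothesis hX : density X.

(** A tensor product of projectors is a projector, so the trace is already real and nonnegative, and
    taking its real part loses nothing. *)
Lemma outcome_probE a b :
  (outcome_prob A B X a b)%:C = \tr (X *m (product_effect A a *t product_effect B b))
  /\ 0 <= outcome_prob A B X a b.
Proof.
have : 0 <= \tr (X *m (product_effect A a *t product_effect B b)).
  apply: psdmx_trace_proj; first exact: hX.1.
    by rewrite adjmx_tens !product_effect_herm.
  by rewrite tensmx_mul !product_effect_idem.
rewrite /outcome_prob -/(product_effect A a) -/(product_effect B b).
case: (\tr _) => x y.
by rewrite lecE /= => /andP[/eqP -> ->].
Qed.

Lemma outcome_prob_weighted (c d : _ -> C) :
  \sum_a \sum_b c a * d b * (outcome_prob A B X a b)%:C
  = \tr (X *m ((\sum_a c a *: product_effect A a)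
               *t (\sum_b d b *: product_effect B b))).
Proof.
rewrite tensmx_suml mulmx_sumr linear_sum; apply: eq_bigr => a _ /=.
rewrite mulmx_sumr linear_sum; apply: eq_bigr => b _ /=.
by rewrite -scalemxAr linearZ /= (outcome_probE a b).1.
Qed.

Lemma outcome_prob_total : \sum_a \sum_b outcome_prob A B X a b = 1.
Proof.
have := outcome_prob_weighted (fun=> 1) (fun=> 1).
rewrite !product_effect_sum// tensmx11 mulmx1 hX.2 => h.
apply: (@complexI R); rewrite -[RHS]h rmorph_sum; apply: eq_bigr => a _.
by rewrite rmorph_sum; apply: eq_bigr => b _; rewrite !mul1r.
Qed.

Definition rsign (s : bool) : R := if s then 1 else -1.

(** Squashing keeps the first photon of each side, so the correlation of the squashed block is the
    mean product of the two first outcomes. *)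
Lemma outcome_prob_mean :
  (\sum_a \sum_b rsign (thead a) * rsign (thead b) * outcome_prob A B X a b)%:C
  = \tr (universal_squash X *m (A *t B)).
Proof.
rewrite universal_squash_tens -!product_effect_mean// -outcome_prob_weighted.
rewrite rmorph_sum; apply: eq_bigr => a _.
rewrite rmorph_sum; apply: eq_bigr => b _.
rewrite !rmorphM; congr (_ * _ * _); rewrite /rsign /sign_of; case: ifP => _;
  by rewrite ?rmorphN rmorph1.
Qed.

(** The function takes plain sequences, so that one [f] serves blocks of every size. *)
Definition averaged (f : seq bool -> seq bool -> R) : R :=
  \sum_(a : n.+1.-tuple bool) \sum_(b : m.+1.-tuple bool)
     f a b * outcome_prob A B X a b.

Lemma ler_averaged (f g : seq bool -> seq bool -> R) :
  (forall (a : n.+1.-tuple bool) (b : m.+1.-tuple bool), f a b <= g a b) ->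
  averaged f <= averaged g.
Proof.
move=> fg; apply: ler_sum => a _; apply: ler_sum => b _.
by apply: ler_wpM2r => //; exact: (outcome_probE a b).2.
Qed.

Lemma averaged_norm (f : seq bool -> seq bool -> R) :
  (forall a b, `|f a b| <= 1) -> `|averaged f| <= 1.
Proof.
move=> f1; rewrite -[leRHS]outcome_prob_total.
apply: (le_trans (ler_norm_sum _ _ _)); apply: ler_sum => a _.
apply: (le_trans (ler_norm_sum _ _ _)); apply: ler_sum => b _.
have p0 := (outcome_probE a b).2.
by rewrite normrM (ger0_norm p0) ler_piMl.
Qed.

End Block.

Definition event_plus (a b : seq bool) :=
  [exists s : bool, single_click s a && single_click s b].
Definition event_minus (a b : seq bool) :=
  [exists s : bool, single_click s a && single_click (~~ s) b].
Definition event_double (a b : seq bool) := double_click a || double_click b.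

(** A nonempty string that misses one of the two letters is constant, equal to its head. An empty
    string would be a single click with both values. *)
Lemma double_clickPn n (a : n.+1.-tuple bool) s :
  single_click s a = ~~ double_click a && (s == thead a).
Proof.
case/tupleP: a => t a; rewrite theadE /single_click /double_click /= !inE.
have mem c : (c \in tval a) = ~~ all (pred1 (~~ c)) a.
  rewrite -has_pred1 -[has _ _]negbK -all_predC; congr (~~ _).
  by apply: eq_all => -[]; case: c.
by rewrite !mem; case: s t => [] [] //=; rewrite ?andbT ?negbK ?andbF.
Qed.

(** With two single clicks, [d = 0] and [e] is the product of the first outcomes; otherwise [e = 0]
    and [d = 1], and a product of signs lies between [-1] and [1]. *)
Lemma event_bounds n m (a : n.+1.-tuple bool) (b : m.+1.-tuple bool) :
  let e := (event_plus a b)%:R - (event_minus a b)%:R : R in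
  let d := (event_double a b)%:R : R in
  e - d <= rsign (thead a) * rsign (thead b) <= e + d.
Proof.
have ex (P : pred bool) : [exists s, P s] = P true || P false.
  apply/existsP/orP => [[[] ->]|[h|h]]; [by left|by right| |].
  - by exists true.
  - by exists false.
rewrite /event_plus /event_minus /event_double /= !ex !double_clickPn /rsign.
by case: (double_click a); case: (double_click b); case: (thead a);
  case: (thead b) => /=; lra.
Qed.

End ThresholdDetection.

(** * The effective two-qubit state and its correlations *)

Section EffectiveState.
Context {R : realType}.

Lemma Re_scalemx m n (c : R) (M : 'M[R[i]]_(m, n)) i j :
  complex.Re ((c%:C *: M) i j) = c * complex.Re (M i j).
Proof. by rewrite mxE complex_ReM mul0r subr0. Qed.

Lemma Im_scalemx m n (c : R) (M : 'M[R[i]]_(m, n)) i j :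
  complex.Im ((c%:C *: M) i j) = c * complex.Im (M i j).
Proof. by rewrite mxE complex_ImM mul0r addr0. Qed.

Variable rho : multiphoton_state R.
Local Notation w := (weight rho).
Local Notation squashed k := (universal_squash (block rho k.1 k.2)).

Lemma weight_rsummable : rsummable w.
Proof.
rewrite /rsummable /summable.
under eq_esum do rewrite /= ger0_norm ?weight_ge0//.
by rewrite weight_sum1 ltry.
Qed.

Lemma rsummable_weight (f : nat * nat -> R) :
  (forall k, `|f k| <= 1) -> rsummable (fun k => w k * f k).
Proof.
move=> f1; apply: rsummable_le weight_rsummable => k.
by rewrite normrM (ger0_norm (weight_ge0 rho k)) ler_piMr ?weight_ge0.
Qed.

Lemma rsum_weight : rsum w = 1.
Proof.
rewrite /rsum [X in _ - fine X]esum1; last first.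
  by move=> k _; rewrite max_r// oppr_le0 weight_ge0.
under eq_esum do rewrite max_l ?weight_ge0//.
by rewrite weight_sum1 subr0.
Qed.

Lemma squashed_density k : density (squashed k).
Proof.
have [hX trX] := block_density rho k.1 k.2.
split; first exact: universal_squash_psd hX.
(* Trace preservation is the duality applied to two identities. *)
rewrite -[squashed k]mulmx1 -tensmx11 universal_squash_tens -[RHS]trX.
have on1 n : tensor_family (on_first 1%:M) = 1%:M :> 'M[R[i]]_(qdim n.+1).
  rewrite -tensor_family1; apply: eq_tensor_family => j.
  by rewrite /on_first if_same.
by rewrite !on1 tensmx11 mulmx1.
Qed.

(** By [density_entries] the weights dominate every entry of the family, so the trace passes through
    the infinite sum. *)
Lemma effective_trace (M : 'M[R[i]]_(2 * 2)) :
  \tr (effective rho *m M) = csum (fun k => (w k)%:C * \tr (squashed k *m M)).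
Proof.
have [|_ ->] := @mxrsum_trace R _ _ _
    (fun k : nat * nat => (w k)%:C *: squashed k) M.
  move=> i j; have e k := density_entries i j (squashed_density k).
  split.
    under eq_fun do rewrite Re_scalemx.
    by apply: rsummable_weight => k; exact: (e k).1.
  under eq_fun do rewrite Im_scalemx.
  by apply: rsummable_weight => k; exact: (e k).2.
by congr csum; apply: funext => k; rewrite -scalemxAl linearZ.
Qed.

Lemma effective_density : density (effective rho).
Proof.
split=> [u|].
  have -> : (u *m effective rho *m u^t*) 0 0
      = \tr (effective rho *m (u^t* *m u)).
    by rewrite mulmxA mxtrace_mulC mulmxA /mxtrace big_ord1.
  rewrite effective_trace; apply: csum_ge0 => k.
  apply: mulr_ge0; first by rewrite ler0c weight_ge0.
  rewrite mulmxA mxtrace_mulC mulmxA /mxtrace big_ord1.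
  exact: (squashed_density k).1.
rewrite -[effective rho]mulmx1 effective_trace /csum.
under [fun k => complex.Re _]eq_fun do
  rewrite mulmx1 (squashed_density _).2 mulr1 /=.
under [fun k => complex.Im _]eq_fun do
  rewrite mulmx1 (squashed_density _).2 mulr1 /=.
rewrite rsum_weight.
by rewrite /rsum !esum1 ?subrr// => k _; rewrite ?oppr0 maxxx.
Qed.

Variables A B : 'M[R[i]]_2.
Hypotheses (hA : pm1_observable A) (hB : pm1_observable B).

Local Notation avg f k := (averaged A B (block rho k.1 k.2) f).

Lemma event_probE E : event_prob rho A B E =
  rsum (fun k => w k * avg (fun a b => (E a b)%:R) k).
Proof.
congr rsum; apply: funext => k; congr (_ * _); apply: eq_bigr => a _.
rewrite big_mkcond; apply: eq_bigr => b _ /=.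
by case: (E a b); rewrite ?mul1r ?mul0r.
Qed.

(** [head true] plays the part of [thead] on plain sequences; its default is never reached, as each
    side of a block has at least one photon. *)
Lemma effective_correlation : \tr (effective rho *m (A *t B)) =
  (rsum (fun k => w k *
     avg (fun a b => rsign (R:=R) (head true a) * rsign (head true b)) k))%:C.
Proof.
rewrite effective_trace.
have e k : \tr (squashed k *m (A *t B)) =
   (avg (fun a b => rsign (R:=R) (head true a) * rsign (head true b)) k)%:C.
  rewrite -(outcome_prob_mean hA hB (block_density rho k.1 k.2)).
  by congr _%:C; apply: eq_bigr => a _; apply: eq_bigr => b _;
    case/tupleP: a => ? ?; case/tupleP: b => ? ?; rewrite !theadE.
rewrite /csum.
under [fun k => complex.Re _]eq_fun do rewrite e complex_ReM /= mul0r subr0.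
under [fun k => complex.Im _]eq_fun do rewrite e complex_ImM /= mul0r mulr0 addr0.
by congr (_ +i* _); rewrite /rsum !esum1 ?subrr// => k _; rewrite ?oppr0 maxxx.
Qed.

(** The pointwise inequalities of [event_bounds] survive averaging over a block and summation with
    the weights. *)
Lemma correlation_bounds :
  let e := P_single_plus rho A B - P_single_minus rho A B in
  let d := P_double rho A B in
  (e - d)%:C <= \tr (effective rho *m (A *t B)) <= (e + d)%:C.
Proof.
rewrite /= effective_correlation !lecR /P_single_plus /P_single_minus /P_double.
rewrite !event_probE -/event_plus -/event_minus -/event_double.
have hd k := block_density rho k.1 k.2.
have s01 (E : seq bool -> seq bool -> bool) :
    rsummable (fun k => w k * avg (fun a b => (E a b)%:R) k).
  apply: rsummable_weight => k; apply: averaged_norm => // a b.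
  by case: (E a b); rewrite ?normr1 ?normr0.
have ss : rsummable (fun k => w k *
    avg (fun a b => rsign (R:=R) (head true a) * rsign (head true b)) k).
  apply: rsummable_weight => k; apply: averaged_norm => // a b.
  by rewrite /rsign; case: (head _ _); case: (head _ _);
    rewrite !(mulrNN, mulr1, mul1r, normrN, normr1).
rewrite -rsumN -rsumD//; last exact: rsummableN.
have sd := rsummableD (s01 event_plus) (rsummableN (s01 event_minus)).
rewrite -rsumN -!rsumD//; last exact/rsummableN/s01.
(* The coefficient [c] will be [-1] for the lower bound and [1] for the upper one. *)
have avgB (f g h : seq bool -> seq bool -> R) k (c : R) :
    avg f k - avg g k + c * avg h k
    = avg (fun a b => f a b - g a b + c * h a b) k.
  rewrite /averaged mulr_sumr -sumrB -big_split; apply: eq_bigr => a _ /=.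
  rewrite mulr_sumr -sumrB -big_split; apply: eq_bigr => b _ /=; ring.
have bnd (n m : nat) (a : n.+1.-tuple bool) (b : m.+1.-tuple bool) :
    (event_plus a b)%:R - (event_minus a b)%:R + -1 * (event_double a b)%:R
    <= rsign (R:=R) (head true a) * rsign (head true b)
    <= (event_plus a b)%:R - (event_minus a b)%:R + 1 * (event_double a b)%:R.
  have := event_bounds (R:=R) a b; rewrite mulN1r mul1r.
  by case/tupleP: a => ? ?; case/tupleP: b => ? ?; rewrite !theadE.
apply/andP; split; apply: ler_rsum => //; try exact: rsummableD.
- by apply: rsummableD => //; exact: rsummableN.
- move=> k; rewrite -mulrN -mulrN -!mulrDr -[X in _ * (_ + X) <= _]mulN1r avgB.
  apply: ler_wpM2l; first exact: weight_ge0.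
  by apply: ler_averaged => // a b; case/andP: (bnd _ _ a b).
- move=> k; rewrite -mulrN -!mulrDr -[X in _ <= _ * (_ + X)]mul1r avgB.
  apply: ler_wpM2l; first exact: weight_ge0.
  by apply: ler_averaged => // a b; case/andP: (bnd _ _ a b).
Qed.

End EffectiveState.

(** * Traces against a bounded real quadratic form *)

Section RealForms.
Context {R : realType}.

Lemma trmx_sq_eq0 m n (X : 'M[R]_(m, n)) : X *m X^T = 0 -> X = 0.
Proof.
move=> X0; apply/matrixP => i j; rewrite mxE.
have /eqP : (X *m X^T) i i = 0 by rewrite X0 mxE.
rewrite mxE psumr_eq0 => [|k _]; last by rewrite mxE -expr2 sqr_ge0.
by move=> /allP/(_ j); rewrite mem_index_enum mxE -expr2 sqrf_eq0 => /(_ isT)/eqP.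
Qed.

Variables (n : nat) (G : 'M[R]_n) (F : R).
Hypothesis hG : forall q : 'rV[R]_n,
  0 <= (q *m G *m q^T) 0 0 <= F * (q *m q^T) 0 0.

(** By cyclicity both traces are sums over the rows of [X], of the form of [G] and of the squared
    norm. *)
Lemma form_trace_gram (X : 'M[R]_n) :
  0 <= \tr (G *m (X^T *m X)) <= F * \tr (X^T *m X).
Proof.
have rowE (M : 'M[R]_n) i :
    (row i X *m M *m (row i X)^T) 0 0 = (X *m M *m X^T) i i.
  rewrite -row_mul tr_row !mxE; apply: eq_bigr => j _.
  by rewrite !mxE.
have -> : \tr (G *m (X^T *m X)) = \sum_i (row i X *m G *m (row i X)^T) 0 0.
  rewrite mulmxA mxtrace_mulC mulmxA; apply: eq_bigr => i _; by rewrite rowE.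
have -> : \tr (X^T *m X) = \sum_i (row i X *m (row i X)^T) 0 0.
  rewrite mxtrace_mulC; apply: eq_bigr => i _.
  by have := rowE 1%:M i; rewrite !mulmx1 => ->.
rewrite mulr_sumr; apply/andP; split.
  by apply: sumr_ge0 => i _; case/andP: (hG (row i X)).
by apply: ler_sum => i _; case/andP: (hG (row i X)).
Qed.

(** Here [X^T X = c X], so the Gram bound holds with a common factor [c] that cancels; [c = 0]
    forces [X = 0]. Eigenprojectors can thus be used without normalization. *)
Lemma form_trace_quasiproj (X : 'M[R]_n) c :
  X^T = X -> X *m X = c *: X -> 0 <= c -> 0 <= \tr (G *m X) <= F * \tr X.
Proof.
move=> Xs XX c0; have [c00|cn0] := eqVneq c 0.
  suff -> : X = 0 by rewrite mulmx0 linear0 mulr0 lexx.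
  by apply: trmx_sq_eq0; rewrite Xs XX c00 scale0r.
have cp : 0 < c by rewrite lt_def cn0.
have := form_trace_gram X; rewrite Xs XX -scalemxAr !linearZ /= mulrCA.
by rewrite pmulr_rge0// ler_pM2l.
Qed.

End RealForms.

(** * From the spectrum of the CHSH matrix to the fidelity bound *)

Section ChshSpectrum.
Context {R : realType}.

Lemma fidelity_scalar_bound (F x l1 l2 : R) :
  l1 ^+ 2 + l2 ^+ 2 = 8 -> 0 <= l2 < l1 -> 2 <= x -> x <= l2 + F * (l1 - l2) ->
  (1 + Num.sqrt ((x / 2) ^+ 2 - 1)) / 2 <= F.
Proof.
move=> sq /andP[l20 l12] x2 xF.
have lsum : l1 + l2 <= 4 by have := sqr_ge0 (l1 - l2); nra.
(* For [F < 1/2] the bound on [x] would fall below [(l1 + l2) / 2], which is at most [2]. *)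
have F2 : 2^-1 <= F by rewrite leNgt; apply/negP => F2; nra.
suff : Num.sqrt ((x / 2) ^+ 2 - 1) <= 2 * F - 1 by lra.
rewrite -[leRHS]ger0_norm; last by lra.
rewrite -sqrtr_sqr ler_wsqrtr//.
have x2F : x ^+ 2 <= (l2 + F * (l1 - l2)) ^+ 2 by rewrite ler_sqr ?nnegrE; lra.
(* The defect in Cauchy-Schwarz for [(F, 1 - F)] and [(l1, l2)]. The resulting bound
   [8 (F^2 + (1 - F)^2)] equals [4 + 4 (2 F - 1)^2]. *)
have cs := sqr_ge0 (F * l2 - (1 - F) * l1).
have : (l2 + F * (l1 - l2)) ^+ 2 <= (F ^+ 2 + (1 - F) ^+ 2) * 8.
  rewrite -sq; lra.
lra.
Qed.

Variables (G S K : 'M[R]_4) (F k : R).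
Hypothesis hG : forall q : 'rV[R]_4,
  0 <= (q *m G *m q^T) 0 0 <= F * (q *m q^T) 0 0.
Hypothesis trG : \tr G = 1.
Hypothesis Ssym : S^T = S.
Hypotheses (trS : \tr S = 0) (trS2 : \tr (S *m S) = 16)
           (trS3 : \tr (S *m S *m S) = 0).
Hypothesis SS : S *m S = 4%:M + K.
Hypothesis KK : K *m K = (k ^+ 2)%:M.

Let KE : K = S *m S - 4%:M. Proof. by rewrite SS addrC addKr. Qed.

Let KS : K *m S = S *m K.
Proof. by rewrite KE mulmxBl mulmxBr mulmxA mul_scalar_mx mul_mx_scalar. Qed.

Let Ksym : K^T = K.
Proof. by rewrite KE linearB /= trmx_mul Ssym tr_scalar_mx. Qed.

(* For t = +-k and l^2 = 4 + t this is 4tl times the projector onto the joint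
   eigenspace where K = t and S = l. *)
Let Y t l := (t%:M + K) *m (l%:M + S).

Let YY t l : t ^+ 2 = k ^+ 2 -> l ^+ 2 = 4 + t ->
  Y t l *m Y t l = (4 * t * l) *: Y t l.
Proof.
move=> tk lt.
have K2 : K ^+ 2 = (t ^+ 2)%:M by rewrite tk -KK.
(* All matrices involved are polynomials in [S], so the identity is proved in the commutative ring
   of polynomials and transported by [h]. *)
pose h : {rmorphism {poly R} -> 'M[R]_4} := horner_mx S.
have hX : h 'X = S by exact: horner_mx_X.
have hC c : h c%:P = c%:M by exact: horner_mx_C.
pose p : {poly R} := 'X ^+ 2 - 4%:P.
have hp : h p = K by rewrite KE /p rmorphB rmorphXn /= hX hC.
have hY : h ((t%:P + p) * (l%:P + 'X)) = Y t l.
  by rewrite rmorphM (rmorphD h t%:P p) (rmorphD h l%:P) hX !hC hp.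
rewrite -mul_scalar_mx -hY -hC -[LHS]/(_ * _) -[RHS]/(_ * _) -!rmorphM.
(* Division by [p ^+ 2 - t ^+ 2], which [h] sends to [0]; the quotient is [(l + X)^2 + 2 t] and the
   remainder the wanted multiple. *)
have -> : (t%:P + p) * (l%:P + 'X) * ((t%:P + p) * (l%:P + 'X)) =
  (p ^+ 2 - (t ^+ 2)%:P) * ((l%:P + 'X) ^+ 2 + 2 * t%:P)
   + (4 * t * l)%:P * ((t%:P + p) * (l%:P + 'X)).
  have -> : t = l ^+ 2 - 4 by lra.
  rewrite /p !(rmorphM, rmorphB, rmorphXn, rmorph_nat) /=; ring.
rewrite (rmorphD h) (rmorphM h (p ^+ 2 - _)) (rmorphB h (p ^+ 2)).
by rewrite (rmorphXn h) hp hC K2 subrr mul0r add0r.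
Qed.

Let Ysym t l : (Y t l)^T = Y t l.
Proof.
have tr c (M : 'M[R]_4) : M^T = M -> (c%:M + M)^T = c%:M + M.
  by move=> Ms; rewrite linearD /= tr_scalar_mx Ms.
rewrite /Y trmx_mul !tr// !mulmxDl !mulmxDr KS.
by rewrite !mul_scalar_mx !mul_mx_scalar !scale_scalar_mx mulrC addrACA.
Qed.

Let YE t l : Y t l = (t * l)%:M + t *: S + (l *: K + K *m S).
Proof.
rewrite /Y mulmxDl !mulmxDr -scalar_mxM mul_scalar_mx mul_mx_scalar.
by [].
Qed.

Let trY t l : \tr (Y t l) = 4 * t * l.
Proof.
rewrite YE !linearD !linearZ /= mxtrace_scalar trS.
rewrite KE mulmxBl mul_scalar_mx !linearB linearZ /= mxtrace_scalar trS trS2 trS3.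
lra.
Qed.

Let chi := \tr (G *m S).

Let trGY t l : \tr (G *m Y t l) =
  t * l + t * chi + (l * \tr (G *m K) + \tr (G *m (K *m S))).
Proof.
rewrite YE !mulmxDr !mxtraceD mul_mx_scalar -!scalemxAr !mxtraceZ trG.
by rewrite mulr1.
Qed.

Let bound_pos t l : t ^+ 2 = k ^+ 2 -> l ^+ 2 = 4 + t -> 0 <= t * l ->
  0 <= \tr (G *m Y t l) <= F * (4 * t * l).
Proof.
move=> tk lt tl; rewrite -trY; apply: (form_trace_quasiproj hG (Ysym t l) (YY tk lt)).
by lra.
Qed.

Let bound_neg t l : t ^+ 2 = k ^+ 2 -> l ^+ 2 = 4 + t -> t * l <= 0 ->
  \tr (G *m Y t l) <= 0.
Proof.
move=> tk lt tl.
have /andP[+ _] : 0 <= \tr (G *m (- Y t l)) <= F * \tr (- Y t l).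
  apply: (form_trace_quasiproj (c := - (4 * t * l)) hG).
  - by rewrite linearN /= Ysym.
  - by rewrite mulmxN mulNmx opprK YY// scaleNr scalerN opprK.
  - by lra.
by rewrite mulmxN linearN /= oppr_ge0.
Qed.

Lemma chsh_spectrum_bound (x : R) : 0 <= k <= 4 -> 2 <= x <= chi ->
  (1 + Num.sqrt ((x / 2) ^+ 2 - 1)) / 2 <= F.
Proof.
move=> /andP[k0 k4] /andP[x2 xchi].
have [kz|kn0] := eqVneq k 0.
  (* Now [2 + S] and [2 - S] square to [4] times themselves. The second gives [chi <= 2], hence
     [x = 2]; the first gives [2 + chi <= 8 F], hence [1/2 <= F]. *)
  have K0 : K = 0.
    by apply: trmx_sq_eq0; rewrite Ksym KK kz expr0n /= raddf0.
  have S4 : S *m S = 4%:M by rewrite SS K0 addr0.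
  have quasi e : e ^+ 2 = 1 ->
      (2%:M + e *: S) *m (2%:M + e *: S) = 4 *: (2%:M + e *: S).
    move=> e1; have eS : e *: S *m (e *: S) = 4%:M.
      by rewrite -scalemxAl -scalemxAr scalerA -expr2 e1 scale1r S4.
    rewrite mulmxDl !mulmxDr eS -scalar_mxM mul_scalar_mx mul_mx_scalar.
    rewrite [X in _ + X]addrC addrACA -raddfD /= -scalerDl scalerDr.
    rewrite scale_scalar_mx.
    by congr (_%:M + _ *: _); lra.
  have bnd e : e ^+ 2 = 1 -> 0 <= 2 + e * chi <= F * 8.
    move=> e1.
    have := form_trace_quasiproj hG _ (quasi e e1) (ler0n _ 4).
    rewrite linearD linearZ /= tr_scalar_mx Ssym => /(_ erefl).
    rewrite mulmxDr mul_mx_scalar -scalemxAr !linearD !linearZ /= trG trS.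
    by rewrite mxtrace_scalar mulr0 addr0 mulr1 => /andP[-> h]; lra.
  have /andP[_ b1] := bnd 1 (expr1n _ _).
  have eN1 : (-1) ^+ 2 = 1 :> R by rewrite sqrrN expr1n.
  have /andP[b2 _] := bnd (-1) eN1.
  have -> : x = 2 by lra.
  rewrite divff ?pnatr_eq0// expr1n subrr sqrtr0; lra.
have kp : 0 < k by rewrite lt_def kn0.
pose l1 := Num.sqrt (4 + k); pose l2 := Num.sqrt (4 - k).
have l1sq : l1 ^+ 2 = 4 + k by rewrite sqr_sqrtr//; lra.
have l2sq : l2 ^+ 2 = 4 - k by rewrite sqr_sqrtr//; lra.
have l20 : 0 <= l2 by exact: sqrtr_ge0.
have l12 : l2 < l1 by rewrite ltr_sqrt; lra.
apply: (@fidelity_scalar_bound F x l1 l2) => //; rewrite ?l20 ?l12//; first lra.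
apply: le_trans xchi _.
have kl1 : 0 <= k * l1 by apply: mulr_ge0 => //; lra.
have kl2 : 0 <= k * l2 by apply: mulr_ge0.
(* Three spectral facts: the weight of [G] at [l1] is at most [F], and its weights at [- l1] and
   [- l2] are nonnegative. *)
have /andP[_] := bound_pos erefl l1sq kl1.
have := @bound_neg k (- l1) erefl _ _; rewrite sqrrN => /(_ l1sq).
rewrite mulrN oppr_le0 => /(_ kl1).
have := @bound_pos (- k) (- l2) (sqrrN _).
rewrite sqrrN mulrNN => /(_ l2sq kl2)/andP[+ _].
rewrite !trGY; set g2 := \tr (G *m K); set g3 := \tr (G *m (K *m S)).
move=> h4 h2 h1.
rewrite -(ler_pM2l kp) -(@ler_pM2l _ (4 * l1)); last by lra.
(* Weighting the three inequalities by [l1 - l2], [l1 + l2] and [2 l1] eliminates [g2] and [g3] and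
   leaves the goal times [4 k l1]; the last factor 2 is supplied by the closing [lra]. *)
have m1 : 0 <= (l1 - l2) *
    (F * (4 * k * l1) - (k * l1 + k * chi + (l1 * g2 + g3))).
  by apply: mulr_ge0; lra.
have m2 : 0 <= (l1 + l2) * - (k * - l1 + k * chi + (- l1 * g2 + g3)).
  by apply: mulr_ge0; lra.
have m4 : 0 <= l1 * (k * l2 + - k * chi + (- l2 * g2 + g3)).
  by apply: mulr_ge0 => //; lra.
lra.
Qed.

End ChshSpectrum.

(** * Left and right quaternion multiplications as real 4x4 matrices *)

Section Quaternions.
Context {R : realType}.
Implicit Types x y z : R.

Definition mx4 (s : seq (seq R)) : 'M[R]_4 :=
  \matrix_(i, j) nth 0 (nth [::] s i) j.

(* Identify q in R^4 with the matrix U(q) = q0 + i (q1 sx + q2 sy + q3 sz) and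
   let a = (x, y, z). In the row-vector convention, [lquat] and [rquat] are the
   maps U |-> - i (a.sigma) U and U |-> - i U (a.sigma). *)
Definition lquat x y z : 'M[R]_4 := mx4
  [:: [:: 0; - x; - y; - z];
      [:: x; 0; z; - y];
      [:: y; - z; 0; x];
      [:: z; y; - x; 0]].

Definition rquat x y z : 'M[R]_4 := mx4
  [:: [:: 0; - x; - y; - z];
      [:: x; 0; - z; y];
      [:: y; z; 0; - x];
      [:: z; - y; x; 0]].

Local Ltac mx4_ring :=
  let hi := fresh in let hj := fresh in
  apply/matrixP => -[[|[|[|[|//]]]] hi] -[[|[|[|[|//]]]] hj];
  rewrite !mxE ?big_ord_recl ?big_ord0 ?mxE /=; ring.

(** With row vectors the left factor acts first, which reverses the order of left multiplications;
    hence the vector product has the opposite sign to that in [rquatM]. *)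
Lemma lquatM x y z x' y' z' : lquat x y z *m lquat x' y' z' =
  (- (x * x' + y * y' + z * z'))%:M
  - lquat (y * z' - z * y') (z * x' - x * z') (x * y' - y * x').
Proof. mx4_ring. Qed.

Lemma rquatM x y z x' y' z' : rquat x y z *m rquat x' y' z' =
  (- (x * x' + y * y' + z * z'))%:M
  + rquat (y * z' - z * y') (z * x' - x * z') (x * y' - y * x').
Proof. mx4_ring. Qed.

(** Associativity of the quaternion product. *)
Lemma lrquatC x y z x' y' z' :
  rquat x' y' z' *m lquat x y z = lquat x y z *m rquat x' y' z'.
Proof. mx4_ring. Qed.

Lemma lquat_tr x y z : (lquat x y z)^T = - lquat x y z.
Proof. mx4_ring. Qed.

Lemma rquat_tr x y z : (rquat x y z)^T = - rquat x y z.
Proof. mx4_ring. Qed.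

Lemma rquatD x y z x' y' z' :
  rquat x y z + rquat x' y' z' = rquat (x + x') (y + y') (z + z').
Proof. mx4_ring. Qed.

Lemma rquatN x y z : - rquat x y z = rquat (- x) (- y) (- z).
Proof. mx4_ring. Qed.

Lemma lquat_sq x y z :
  lquat x y z *m lquat x y z = (- (x ^+ 2 + y ^+ 2 + z ^+ 2))%:M.
Proof. mx4_ring. Qed.

Lemma rquat_sq x y z :
  rquat x y z *m rquat x y z = (- (x ^+ 2 + y ^+ 2 + z ^+ 2))%:M.
Proof. mx4_ring. Qed.

Lemma lquatN x y z : - lquat x y z = lquat (- x) (- y) (- z).
Proof. mx4_ring. Qed.

Lemma lrquat_trace x y z x' y' z' : \tr (lquat x y z *m rquat x' y' z') = 0.
Proof.
rewrite /mxtrace !big_ord_recl big_ord0 !mxE !big_ord_recl !big_ord0 !mxE /=.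
ring.
Qed.

End Quaternions.

(** * The magic basis of two qubits *)

Section MagicBasis.
Context {R : realType}.
Local Notation C := R[i].
Local Notation "M ^%C" := (map_mx (real_complex R) M)
  (at level 2, format "M ^%C").

(* Row i of [magic] is the vectorization of U(e_i). *)
Definition magic_entry (i : nat) (k l : 'I_2) : C :=
  match i with
  | 0%N => if k == l then 1 else 0
  | 1%N => if k == l then 0 else 'i
  | 2%N => if k == l then 0 else if k == 0 then 1 else - 1
  | _ => if k == l then (if k == 0 then 'i else - 'i) else 0
  end.

Definition magic : 'M[C]_(4, 2 * 2) :=
  \matrix_(i, p) magic_entry i (mxtens_unindex p).1 (mxtens_unindex p).2.

Lemma magicE i k l : magic i (mxtens_index (k, l)) = magic_entry i k l.
Proof. by rewrite mxE mxtens_indexK. Qed.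

Local Ltac ord2_cases k :=
  let hk := fresh in case: k => -[|[|//]] hk.
Local Ltac ord4_cases k :=
  let hk := fresh in case: k => -[|[|[|[|//]]]] hk.

(** The rows are left unnormalized to avoid square roots: [magic] is the square root of 2 times a
    unitary, whence the factors [2] and [2^-1] in changes of basis. *)
Lemma magic_adj : magic *m magic^t* = 2%:M.
Proof.
apply/matrixP => i j; rewrite mxE sum_mxtens !big_ord_recl !big_ord0.
rewrite ![magic^t* _ _]mxE ![magic^T _ _]mxE !magicE !conjCE.
ord4_cases i; ord4_cases j; rewrite !mxE;
  by apply/eqP; rewrite eq_complex /=; apply/andP; split; apply/eqP; ring.
Qed.

Lemma magic_adjK : magic^t* *m magic = 2%:M.
Proof.
have h : magic *m (2^-1 *: magic^t*) = 1%:M.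
  by rewrite -scalemxAr magic_adj scale_scalar_mx mulVf ?pnatr_eq0.
have := mulmx1C h; rewrite -scalemxAl => /(congr1 (fun M => 2 *: M)).
by rewrite scalerA mulfV ?pnatr_eq0// scale1r scale_scalar_mx mulr1.
Qed.

(* A (x) B maps the vectorization of U to that of A^T U B, and transposing a
   Pauli combination flips the sign of its y component. *)
Lemma magic_tens x y z x' y' z' :
  magic *m (pauli x y z *t pauli x' y' z')
  = (- (lquat x (- y) z *m rquat x' y' z'))^%C *m magic.
Proof.
apply/matrixP => i p; case: (mxtens_indexP p) => k l.
rewrite mxE sum_mxtens !big_ord_recl !big_ord0 !tensmxE !magicE.
rewrite [RHS]mxE !big_ord_recl !big_ord0 !magicE !mxE.
rewrite !big_ord_recl !big_ord0 !mxE.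
by ord4_cases i; ord2_cases k; ord2_cases l;
  apply/eqP; rewrite eq_complex /=; apply/andP; split; apply/eqP; ring.
Qed.

End MagicBasis.

(** * The CHSH operator in the magic basis *)

Section MagicChsh.
Context {R : realType}.

(** Bilinearity pairs the first observable with the sum of the other side's two and the second with
    their difference. The negated [y1] and [y2] come from [magic_tens]. *)
Lemma magic_chsh (x1 y1 z1 x2 y2 z2 u1 v1 w1 u2 v2 w2 : R) :
  magic *m (pauli x1 y1 z1 *t pauli u1 v1 w1 + pauli x1 y1 z1 *t pauli u2 v2 w2
          + pauli x2 y2 z2 *t pauli u1 v1 w1 - pauli x2 y2 z2 *t pauli u2 v2 w2)
  = map_mx (real_complex R)
      (- (lquat x1 (- y1) z1 *m rquat (u1 + u2) (v1 + v2) (w1 + w2)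
          + lquat x2 (- y2) z2 *m rquat (u1 - u2) (v1 - v2) (w1 - w2))) *m magic.
Proof.
rewrite mulmxBr 2!mulmxDr.
rewrite (magic_tens x1 y1 z1 u1 v1 w1) (magic_tens x1 y1 z1 u2 v2 w2).
rewrite (magic_tens x2 y2 z2 u1 v1 w1) (magic_tens x2 y2 z2 u2 v2 w2).
rewrite -2!mulmxDl -mulmxBl -rquatD -(rquatD u1 v1 w1 (- u2)) -rquatN.
congr (_ *m _).
move: (lquat x1 _ _) (lquat x2 _ _) (rquat u1 _ _) (rquat u2 _ _) => L1 L2 R1 R2.
rewrite mulmxDr mulmxBr.
move: (L1 *m R1) (L1 *m R2) (L2 *m R1) (L2 *m R2) => M N P Q.
apply/matrixP => i j; rewrite !mxE.
by apply/eqP; rewrite eq_complex /=; apply/andP; split; apply/eqP; ring.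
Qed.

End MagicChsh.

(** * The algebra of the CHSH matrix *)

Section ChshQuaternion.
Context {R : realType}.

(* (u1, v1, w1) and (u2, v2, w2) stand for b1 + b2 and b1 - b2, where b1 and b2
   are the Bloch vectors of B_1 and B_2; the CHSH operator is
   A_1 (x) (B_1 + B_2) + A_2 (x) (B_1 - B_2). *)
Lemma chsh_quaternion (x1 y1 z1 x2 y2 z2 u1 v1 w1 u2 v2 w2 : R) :
  x1 ^+ 2 + y1 ^+ 2 + z1 ^+ 2 = 1 -> x2 ^+ 2 + y2 ^+ 2 + z2 ^+ 2 = 1 ->
  u1 * u2 + v1 * v2 + w1 * w2 = 0 ->
  u1 ^+ 2 + v1 ^+ 2 + w1 ^+ 2 + (u2 ^+ 2 + v2 ^+ 2 + w2 ^+ 2) = 4 ->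
  let S := - (lquat x1 y1 z1 *m rquat u1 v1 w1
              + lquat x2 y2 z2 *m rquat u2 v2 w2) in
  exists K k, [/\ S^T = S, \tr S = 0, \tr (S *m S) = 16 & \tr (S *m S *m S) = 0]
    /\ [/\ S *m S = 4%:M + K, K *m K = (k ^+ 2)%:M & 0 <= k <= 4].
Proof.
move=> a1 a2 bo bn.
(* The vector products [n] of the two left vectors and [m] of the two right ones, which make up the
   non-scalar part of [S *m S]. *)
pose n1 := y1 * z2 - z1 * y2; pose n2 := z1 * x2 - x1 * z2.
pose n3 := x1 * y2 - y1 * x2.
pose m1 := v1 * w2 - w1 * v2; pose m2 := w1 * u2 - u1 * w2.
pose m3 := u1 * v2 - v1 * u2.
have LR11 := lrquatC x1 y1 z1 u1 v1 w1; have LR12 := lrquatC x1 y1 z1 u2 v2 w2.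
have LR21 := lrquatC x2 y2 z2 u1 v1 w1; have LR22 := lrquatC x2 y2 z2 u2 v2 w2.
have LRnm := lrquatC n1 n2 n3 m1 m2 m3.
have LR1m := lrquatC x1 y1 z1 m1 m2 m3; have LR2m := lrquatC x2 y2 z2 m1 m2 m3.
have tr11 := lrquat_trace x1 y1 z1 u1 v1 w1.
have tr22 := lrquat_trace x2 y2 z2 u2 v2 w2.
have trnm := lrquat_trace n1 n2 n3 m1 m2 m3.
(* A vector product is orthogonal to its factors, so both bracketed products have no scalar part and
   [lrquat_trace] applies. *)
have trn1 : \tr ((lquat n1 n2 n3 *m lquat x1 y1 z1) *m
                  (rquat m1 m2 m3 *m rquat u1 v1 w1)) = 0.
  have -> : lquat n1 n2 n3 *m lquat x1 y1 z1
      = - lquat (n2 * z1 - n3 * y1) (n3 * x1 - n1 * z1) (n1 * y1 - n2 * x1).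
    rewrite lquatM (_ : _ + _ + _ = 0) ?oppr0 ?raddf0 ?add0r// /n1 /n2 /n3; ring.
  have -> : rquat m1 m2 m3 *m rquat u1 v1 w1
      = rquat (m2 * w1 - m3 * v1) (m3 * u1 - m1 * w1) (m1 * v1 - m2 * u1).
    rewrite rquatM (_ : _ + _ + _ = 0) ?oppr0 ?raddf0 ?add0r// /m1 /m2 /m3; ring.
  by rewrite mulNmx linearN /= lrquat_trace oppr0.
have trn2 : \tr ((lquat n1 n2 n3 *m lquat x2 y2 z2) *m
                  (rquat m1 m2 m3 *m rquat u2 v2 w2)) = 0.
  have -> : lquat n1 n2 n3 *m lquat x2 y2 z2
      = - lquat (n2 * z2 - n3 * y2) (n3 * x2 - n1 * z2) (n1 * y2 - n2 * x2).
    rewrite lquatM (_ : _ + _ + _ = 0) ?oppr0 ?raddf0 ?add0r// /n1 /n2 /n3; ring.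
  have -> : rquat m1 m2 m3 *m rquat u2 v2 w2
      = rquat (m2 * w2 - m3 * v2) (m3 * u2 - m1 * w2) (m1 * v2 - m2 * u2).
    rewrite rquatM (_ : _ + _ + _ = 0) ?oppr0 ?raddf0 ?add0r// /m1 /m2 /m3; ring.
  by rewrite mulNmx linearN /= lrquat_trace oppr0.
have L12 := lquatM x1 y1 z1 x2 y2 z2; rewrite -/n1 -/n2 -/n3 in L12.
have L21 : lquat x2 y2 z2 *m lquat x1 y1 z1
    = (- (x1 * x2 + y1 * y2 + z1 * z2))%:M + lquat n1 n2 n3.
  rewrite lquatM lquatN.
  by congr (_%:M + lquat _ _ _); rewrite /n1 /n2 /n3; ring.
have R12 : rquat u1 v1 w1 *m rquat u2 v2 w2 = rquat m1 m2 m3.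
  by rewrite rquatM bo oppr0 raddf0 add0r.
have R21 : rquat u2 v2 w2 *m rquat u1 v1 w1 = - rquat m1 m2 m3.
  rewrite rquatM rquatN (_ : _ + _ + _ = 0) ?oppr0 ?raddf0 ?add0r; last by lra.
  by congr (rquat _ _ _); rewrite /m1 /m2 /m3; ring.
have L11 := lquat_sq x1 y1 z1; rewrite a1 in L11.
have L22 := lquat_sq x2 y2 z2; rewrite a2 in L22.
have R11 := rquat_sq u1 v1 w1; have R22 := rquat_sq u2 v2 w2.
have Lnn := lquat_sq n1 n2 n3; have Rmm := rquat_sq m1 m2 m3.
have L1t := lquat_tr x1 y1 z1; have L2t := lquat_tr x2 y2 z2.
have R1t := rquat_tr u1 v1 w1; have R2t := rquat_tr u2 v2 w2.
(* From here on the six matrices are abstract, known only through the relations just collected. *)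
move: (lquat x1 y1 z1) (lquat x2 y2 z2) (lquat n1 n2 n3)
  (rquat u1 v1 w1) (rquat u2 v2 w2) (rquat m1 m2 m3)
  LR11 LR12 LR21 LR22 LRnm LR1m LR2m tr11 tr22 trnm trn1 trn2 L12 L21 R12 R21
  L11 L22 R11 R22 Lnn Rmm L1t L2t R1t R2t.
move=> L1 L2 Ln R1 R2 Rm LR11 LR12 LR21 LR22 LRnm LR1m LR2m.
move=> tr11 tr22 trnm trn1 trn2.
move=> L12 L21 R12 R21 L11 L22 R11 R22 Lnn Rmm L1t L2t R1t R2t S.
have mulLR (L L' M M' : 'M[R]_4) : M *m L' = L' *m M ->
    (L *m M) *m (L' *m M') = (L *m L') *m (M *m M').
  by move=> c; rewrite mulmxA -[L *m M *m L']mulmxA c !mulmxA.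
pose K := - (2 *: (Ln *m Rm)).
have SS : S *m S = 4%:M + K.
  rewrite mulmxN mulNmx opprK mulmxDl !mulmxDr.
  rewrite (mulLR _ _ _ _ LR11) (mulLR _ _ _ _ LR12).
  rewrite (mulLR _ _ _ _ LR21) (mulLR _ _ _ _ LR22).
  rewrite L11 L12 L21 L22 R11 R12 R21 R22 mulmxN mulmxBl mulmxDl.
  rewrite -!scalar_mxM mul_scalar_mx /K.
  move: (Ln *m Rm) => P; apply/matrixP => i j; rewrite !mxE.
  by case: (i == j); rewrite /= ?mulr1n ?mulr0n; lra.
have trK : \tr K = 0 by rewrite linearN linearZ /= trnm mulr0 oppr0.
have trKS : \tr (K *m S) = 0.
  rewrite mulNmx mulmxN opprK -scalemxAl linearZ /= mulmxDr linearD /=.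
  by rewrite (mulLR _ _ _ _ LR1m) (mulLR _ _ _ _ LR2m) trn1 trn2 addr0 mulr0.
pose N := n1 ^+ 2 + n2 ^+ 2 + n3 ^+ 2; pose M := m1 ^+ 2 + m2 ^+ 2 + m3 ^+ 2.
have N0 : 0 <= N by rewrite !addr_ge0 ?sqr_ge0.
have M0 : 0 <= M by rewrite !addr_ge0 ?sqr_ge0.
have N1 : N <= 1.
  (* Lagrange's identity for the vector product of two unit vectors. *)
  have -> : N = 1 * 1 - (x1 * x2 + y1 * y2 + z1 * z2) ^+ 2.
    by rewrite -{1}a1 -a2 /N /n1 /n2 /n3; ring.
  by rewrite mul1r lerBlDr lerDl sqr_ge0.
have M4 : M <= 4.
  pose c := u1 ^+ 2 + v1 ^+ 2 + w1 ^+ 2; pose d := u2 ^+ 2 + v2 ^+ 2 + w2 ^+ 2.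
  (* Lagrange's identity for orthogonal vectors; [c + d = 4] then gives [c d <= 4]. *)
  have -> : M = c * d - 0 ^+ 2 by rewrite -bo /M /c /d /m1 /m2 /m3; ring.
  have := sqr_ge0 (c - d); rewrite -/c -/d in bn; nra.
(* [K *m K] is [4 Ln^2 Rm^2 = 4 N M], and [N M <= 4] makes the root at most [2]. *)
exists K, (2 * Num.sqrt (N * M)).
split; split => //.
- rewrite linearN linearD /= !trmx_mul L1t L2t R1t R2t !mulmxN !mulNmx !opprK.
  by rewrite LR11 LR22.
- by rewrite linearN linearD /= tr11 tr22 addr0 oppr0.
- by rewrite SS linearD /= mxtrace_scalar trK addr0; lra.
- rewrite SS mulmxDl linearD /= trKS mul_scalar_mx linearZ /= linearN linearD /=.
  by rewrite tr11 tr22 ?(addr0, oppr0, mulr0).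
- rewrite mulmxN mulNmx opprK -scalemxAl -scalemxAr scalerA.
  rewrite (mulLR _ _ _ _ LRnm) Lnn Rmm.
  rewrite -scalar_mxM scale_scalar_mx exprMn sqr_sqrtr ?mulr_ge0//.
  by congr (_%:M); rewrite /N /M; ring.
- rewrite mulr_ge0 ?sqrtr_ge0//=.
  have -> : 4 = 2 * Num.sqrt (2 ^+ 2) :> R by rewrite sqrtr_sqr ger0_norm//; lra.
  rewrite ler_pM2l// ler_wsqrtr//; nra.
Qed.

End ChshQuaternion.

(** * Fidelity as a bound on a real quadratic form *)

Section Fidelity.
Context {R : realType}.
Local Notation C := R[i].
Local Notation "M ^%C" := (map_mx (real_complex R) M)
  (at level 2, format "M ^%C").
Local Notation "M ^Re" := (map_mx (@complex.Re R) M)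
  (at level 2, format "M ^Re").

Lemma Re_mulmxl m n p (Q : 'M[R]_(m, n)) (M : 'M[C]_(n, p)) :
  (Q^%C *m M)^Re = Q *m M^Re.
Proof.
apply/matrixP => i j; rewrite !mxE complex_Re_sum; apply: eq_bigr => k _.
by rewrite !mxE complex_ReM /= mul0r subr0.
Qed.

Lemma Re_mulmxr m n p (M : 'M[C]_(m, n)) (Q : 'M[R]_(n, p)) :
  (M *m Q^%C)^Re = M^Re *m Q.
Proof.
apply/matrixP => i j; rewrite !mxE complex_Re_sum; apply: eq_bigr => k _.
by rewrite !mxE complex_ReM /= mulr0 subr0.
Qed.

Lemma Re_trace n (M : 'M[C]_n) : complex.Re (\tr M) = \tr M^Re.
Proof.
by rewrite /mxtrace complex_Re_sum; apply: eq_bigr => i _; rewrite mxE.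
Qed.

Lemma real_adj m n (Q : 'M[R]_(m, n)) : (Q^%C)^t* = (Q^T)^%C.
Proof. by apply/matrixP => i j; rewrite !mxE conjCE conjc_real. Qed.

Lemma mx11E (M : 'M[C]_1) : M 0 0 = \tr M.
Proof. by rewrite /mxtrace big_ord1. Qed.

Definition bell (q : 'rV[R]_4) : 'rV[C]_(2 * 2) := q^%C *m magic.

(** [U(q)] is a scalar multiple of a unitary, so both reduced states are scalar. The norm
    compensates for the rows of [magic], whose squared norm is [2]. *)
Lemma bell_max_entangled q : (q *m q^T) 0 0 = 2^-1 -> max_entangled (bell q).
Proof.
move=> q2; have qq : q *m q^T = (2^-1)%:M by rewrite [LHS]mx11_scalar q2.
have entry p p' : ((bell q)^t* *m bell q) p p' = conjc (bell q 0 p) * bell q 0 p'.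
  by rewrite mxE big_ord1 !mxE conjCE.
have bellE k l : bell q 0 (mxtens_index (k, l)) =
    \sum_i (q 0 i)%:C * magic_entry i k l.
  by rewrite mxE; apply: eq_bigr => i _; rewrite magicE mxE.
move: q2; rewrite mxE !big_ord_recl big_ord0 !mxE => q2.
have half : 2^-1 = (2^-1)%:C :> C by rewrite fmorphV rmorph_nat.
split.
- rewrite adjmxM real_adj mulmxA -[q^%C *m magic *m _]mulmxA magic_adj.
  rewrite mul_mx_scalar -scalemxAl -map_mxM qq map_scalar_mx scale_scalar_mx.
  by rewrite /= fmorphV rmorph_nat mulfV ?pnatr_eq0.
- rewrite half; apply: matrix2P;
    rewrite !mxE !big_ord_recl big_ord0 !entry !bellE;
    rewrite !big_ord_recl !big_ord0 ?mulr0n ?mulr1n;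
    move: (q _ _) (q _ _) (q _ _) (q _ _) q2 => q0 q1 q2 q3 h;
    by apply/eqP; rewrite eq_complex /=; apply/andP; split; apply/eqP; lra.
- rewrite half; apply: matrix2P;
    rewrite !mxE !big_ord_recl big_ord0 !entry !bellE;
    rewrite !big_ord_recl !big_ord0 ?mulr0n ?mulr1n;
    move: (q _ _) (q _ _) (q _ _) (q _ _) q2 => q0 q1 q2 q3 h;
    by apply/eqP; rewrite eq_complex /=; apply/andP; split; apply/eqP; lra.
Qed.

Variable sigma : 'M[C]_(2 * 2).
Hypothesis hs : density sigma.

Lemma fidelity_ge Phi : max_entangled Phi ->
  complex.Re ((Phi *m sigma *m Phi^t*) 0 0) <= fidelity sigma.
Proof.
move=> hPhi; apply: ub_le_sup; last by exists Phi.
(* A supremum dominates its set only if the set is bounded: [1 - P] is a projector, so each value is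
   at most [\tr sigma = 1]. *)
exists 1 => _ [Psi [Psi1 _ _] <-].
pose P := Psi^t* *m Psi.
have PP : P *m P = P by rewrite /P mulmxA -[Psi^t* *m Psi *m _]mulmxA Psi1 mulmx1.
have Pt : P^t* = P by rewrite adjmxM trmxCK.
have : 0 <= \tr (sigma *m (1%:M - P)).
  apply: psdmx_trace_proj; first exact: hs.1.
    by rewrite linearB /= map_mxB trmx1 map_mx1 Pt.
  by rewrite mulmxBl !mulmxBr !mul1mx mulmx1 PP subrr subr0.
rewrite mulmxBr mulmx1 linearB /= hs.2 subr_ge0.
move=> h; rewrite mx11E mxtrace_mulC mulmxA mxtrace_mulC.
by move: h; rewrite lecE => /andP[_].
Qed.

(** Real vectors and real operators in the magic basis see only this real part of [sigma]; the
    factor restores trace one. *)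
Let G : 'M[R]_4 := 2^-1 *: (magic *m sigma *m magic^t*)^Re.

Lemma bell_form (q : 'rV[R]_4) : (q *m G *m q^T) 0 0 =
  2^-1 * complex.Re ((bell q *m sigma *m (bell q)^t*) 0 0).
Proof.
rewrite /G -scalemxAr -scalemxAl mxE; congr (_ * _).
rewrite -Re_mulmxl -Re_mulmxr mxE adjmxM real_adj.
by rewrite /bell !mulmxA.
Qed.

Lemma bell_form_bounds (q : 'rV[R]_4) :
  0 <= (q *m G *m q^T) 0 0 <= fidelity sigma * (q *m q^T) 0 0.
Proof.
apply/andP; split.
  rewrite bell_form mulr_ge0 ?invr_ge0//.
  by have := hs.1 (bell q); rewrite lecE => /andP[].
pose N := (q *m q^T) 0 0.
have N0 : 0 <= N by rewrite /N mxE sumr_ge0// => i _; rewrite mxE -expr2 sqr_ge0.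
have [N00|Nn0] := eqVneq N 0.
  suff -> : q = 0 by rewrite !mul0mx mxE mulr0.
  apply: trmx_sq_eq0; rewrite [LHS]mx11_scalar -/N N00.
  by rewrite raddf0.
have Np : 0 < N by rewrite lt_def Nn0.
(* Dividing [q] by [c] gives the squared norm [2^-1] required by [bell_max_entangled]. *)
pose c := Num.sqrt (2 * N).
have c2 : c ^+ 2 = 2 * N by rewrite sqr_sqrtr// mulr_ge0.
have c0 : c != 0 by rewrite sqrtr_eq0 -ltNge mulr_gt0.
have [q' qE] : exists q', q = c *: q'.
  by exists (c^-1 *: q); rewrite scalerA mulfV// scale1r.
have qform (M : 'M[R]_4) : (q *m M *m q^T) 0 0 = c ^+ 2 * (q' *m M *m q'^T) 0 0.
  by rewrite qE [(c *: q')^T]linearZ /= -!scalemxAl -scalemxAr scalerA mxE expr2.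
have N' : (q' *m q'^T) 0 0 = 2^-1.
  have := qform 1%:M; rewrite !mulmx1 -/N c2 => h.
  by apply: (mulfI Nn0); rewrite {2}h; field.
have := fidelity_ge (bell_max_entangled N').
rewrite qform -/N bell_form c2; move: (complex.Re _) (fidelity _) => y F yF.
suff : N * y <= N * F by lra.
by rewrite ler_pM2l.
Qed.

Lemma bell_form_trace : \tr G = 1.
Proof.
rewrite linearZ /= -Re_trace mxtrace_mulC mulmxA magic_adjK.
rewrite mul_scalar_mx linearZ /= hs.2.
by rewrite mulr1 /= mulVf ?pnatr_eq0.
Qed.

Lemma bell_form_trace_mul (S : 'M[R]_4) (M : 'M[C]_(2 * 2)) :
  magic *m M = S^%C *m magic -> \tr (G *m S) = complex.Re (\tr (sigma *m M)).
Proof.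
move=> MS.
have SE : S^%C = 2^-1 *: (magic *m M *m magic^t*).
  by rewrite MS -mulmxA magic_adj mul_mx_scalar scalerA mulVf ?scale1r.
rewrite /G -scalemxAl linearZ /= -Re_mulmxr -Re_trace SE -scalemxAr linearZ /=.
have -> : \tr (magic *m sigma *m magic^t* *m (magic *m M *m magic^t*))
    = 2 * (2 * \tr (sigma *m M)).
  rewrite !mulmxA -[_ *m magic^t* *m magic]mulmxA magic_adjK mul_mx_scalar.
  rewrite mxtrace_mulC -!scalemxAl -scalemxAr linearZ /= !mulmxA magic_adjK.
  by rewrite mul_scalar_mx -!scalemxAl linearZ.
rewrite [2^-1 * (_ * _)]mulrA mulVf ?pnatr_eq0// mul1r.
case: (\tr _) => a b /=; lra.
Qed.

Lemma chsh_fidelity (A0 A1 B0 B1 : 'M[C]_2) (x : R) :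
  pm1_observable A0 -> pm1_observable A1 ->
  pm1_observable B0 -> pm1_observable B1 ->
  2 <= x -> x <= complex.Re
    (\tr (sigma *m (A0 *t B0 + A0 *t B1 + A1 *t B0 - A1 *t B1))) ->
  (1 + Num.sqrt ((x / 2) ^+ 2 - 1)) / 2 <= fidelity sigma.
Proof.
move=> /pm1_pauli[x1 [y1 [z1 [a1 ->]]]] /pm1_pauli[x2 [y2 [z2 [a2 ->]]]].
move=> /pm1_pauli[u1 [v1 [w1 [b1 ->]]]] /pm1_pauli[u2 [v2 [w2 [b2 ->]]]] x2' xle.
have a1' : x1 ^+ 2 + (- y1) ^+ 2 + z1 ^+ 2 = 1 by rewrite sqrrN.
have a2' : x2 ^+ 2 + (- y2) ^+ 2 + z2 ^+ 2 = 1 by rewrite sqrrN.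
(* The sum and the difference of two unit vectors are orthogonal, and by the parallelogram law their
   squared norms add up to 4. *)
have orth : (u1 + u2) * (u1 - u2) + (v1 + v2) * (v1 - v2)
    + (w1 + w2) * (w1 - w2) = 0
  by clear -b1 b2; lra.
have norm4 : (u1 + u2) ^+ 2 + (v1 + v2) ^+ 2 + (w1 + w2) ^+ 2
    + ((u1 - u2) ^+ 2 + (v1 - v2) ^+ 2 + (w1 - w2) ^+ 2) = 4
  by clear -b1 b2; lra.
have [K [k [[S1 S2 S3 S4] [SS KK k04]]]] := chsh_quaternion a1' a2' orth norm4.
apply: (chsh_spectrum_bound bell_form_bounds bell_form_trace S1 S2 S3 S4 SS KK k04).
by rewrite x2' (bell_form_trace_mul (magic_chsh _ _ _ _ _ _ _ _ _ _ _ _)).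
Qed.

End Fidelity.

(** * Assembly of the correlation, CHSH and fidelity bounds *)

Lemma chsh_interval (R : realType) (e00 e01 e10 e11 : R[i])
    (l00 l01 l10 l11 u00 u01 u10 u11 : R) :
  l00%:C <= e00 <= u00%:C -> l01%:C <= e01 <= u01%:C ->
  l10%:C <= e10 <= u10%:C -> l11%:C <= e11 <= u11%:C ->
  (l00 + l01 + l10 - u11)%:C <= e00 + e01 + e10 - e11
    <= (u00 + u01 + u10 - l11)%:C.
Proof.
move=> /andP[h1 h2] /andP[h3 h4] /andP[h5 h6] /andP[h7 h8].
rewrite !rmorphB !rmorphD /=; apply/andP; split.
  by apply: lerB => //; apply: lerD => //; apply: lerD.
by apply: lerB => //; apply: lerD => //; apply: lerD.
Qed.

(** The correlations are complex traces; in the order of [R[i]] the two-sided bounds also assert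
    that they are real. *)
Theorem corollary2 (R : realType) (rho : multiphoton_state R)
    (A B : 'I_2 -> 'M[R[i]]_2)
    (hA : forall i, pm1_observable (A i))
    (hB : forall j, pm1_observable (B j)) :
  let sigma := effective rho in
  let EL := fun i j : 'I_2 => P_single_plus rho (A i) (B j)
    - P_single_minus rho (A i) (B j) - P_double rho (A i) (B j) in
  let EU := fun i j : 'I_2 => P_single_plus rho (A i) (B j)
    - P_single_minus rho (A i) (B j) + P_double rho (A i) (B j) in
  let E := fun i j : 'I_2 => \tr (sigma *m (A i *t B j)) in
  let chi := E 0 0 + E 0 1 + E 1 0 - E 1 1 in
  let chiL := EL 0 0 + EL 0 1 + EL 1 0 - EU 1 1 in
  let chiU := EU 0 0 + EU 0 1 + EU 1 0 - EL 1 1 in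
  [/\ forall i j : 'I_2, (EL i j)%:C <= E i j <= (EU i j)%:C,
      chiL%:C <= chi <= chiU%:C &
      2 <= chiL ->
      (1 + Num.sqrt ((chiL / 2) ^+ 2 - 1)) / 2 <= fidelity sigma].
Proof.
move=> sigma EL EU E chi chiL chiU.
have hE i j : (EL i j)%:C <= E i j <= (EU i j)%:C by exact: correlation_bounds.
have hchi : chiL%:C <= chi <= chiU%:C by exact: chsh_interval.
split=> // chiL2.
apply: (chsh_fidelity (effective_density rho) (hA 0) (hA 1) (hB 0) (hB 1) chiL2).
have <- : chi =
    \tr (sigma *m (A 0 *t B 0 + A 0 *t B 1 + A 1 *t B 0 - A 1 *t B 1)).
  by rewrite mulmxBr 2!mulmxDr linearB /= 2!mxtraceD.
by have /andP[+ _] := hchi; rewrite lecE => /andP[_].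
Qed.
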